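(* Let $w \in H_1 = L^2(\Omega,\mu)$ be a function that is non-zero almost everywhere and assume that the kernel $\ker A_{21}$ is spanned by $w$. Assume that the matrix $V(\theta) \in \mathbb{C}^{N \times N}$ is dissipative for almost all $\theta \in \Omega$. Then the following are equivalent for the coupled operator $C$ defined in the context: (i) The operator $C$ does not have any eigenvalues in $\mathrm{i}\mathbb{R} \setminus \{0\}$. (ii) For every $\mathrm{i}\beta \in \mathrm{i}\mathbb{R} \setminus \{0\}$ and every measurable subset $\widetilde{\Omega} \subseteq \Omega$ with full measure one has $\bigcap_{\theta \in \widetilde{\Omega}} \ker(\mathrm{i}\beta - V(\theta)) = \{0\}$. If, in addition, the domain $\operatorname{dom}(A_{21})$, endowed with the graph norm of $A_{21}$, embeds compactly into $H_1$, then (i) and (ii) are also equivalent to: (iii) The semigroup $(e^{tC})_{t \ge 0}$ converges with respect to the operator norm as $t \to \infty$.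
   Context: Inner products on complex Hilbert spaces are linear in the first and antilinear in the second component. Let $(\Omega,\mu)$ be a measure space, $H_1 := L^2(\Omega,\mu)$ (complex-valued functions), let $H_2$ be a complex Hilbert space, with $H_1$ and $H_2$ non-zero, and let $A_{21}: \operatorname{dom}(A_{21}) \subseteq H_1 \to H_2$ be a closed and densely defined linear operator with adjoint $A_{21}^*: \operatorname{dom}(A_{21}^* ) \subseteq H_2 \to H_1$. Fix an integer $N \ge 1$ and, for each $k \in \{1,\dots,N\}$, a bounded linear operator $S_k: H_2 \to H_2$ with $\operatorname{Re}(S_k h | h) \ge \nu \|h\|^2$ for all $h \in H_2$, where $\nu > 0$ does not depend on $k$. Define $A_{S_k}$ on $H_1$ by $$\operatorname{dom}(A_{S_k}) = \{ h_1 \in \operatorname{dom}(A_{21}) : S_k A_{21} h_1 \in \operatorname{dom}(A_{21}^* ) \}, \qquad A_{S_k} h_1 = -A_{21}^* S_k A_{21} h_1.$$ Each $A_{S_k}$ generates a contractive analytic $C_0$-semigroup on $H_1$. Let $V: \Omega \to \mathbb{C}^{N\times N}$ be measurable and essentially bounded; $V$ also denotes the bounded multiplication operator $u \mapsto Vu$ on $H_1^N \simeq L^2(\Omega,\mu;\mathbb{C}^N)$. The coupled operator is $$C: \operatorname{dom}(A_{S_1}) \times \dots \times \operatorname{dom}(A_{S_N}) \subseteq H_1^N \to H_1^N, \qquad C := \operatorname{diag}(A_{S_1},\dots,A_{S_N}) + V.$$ As a bounded perturbation of a generator, $C$ generates a $C_0$-semigroup $(e^{tC})_{t\ge0}$ on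 $H_1^N$. A matrix $M \in \mathbb{C}^{N\times N}$ is dissipative if $\operatorname{Re}(M\xi|\xi) \le 0$ for all $\xi \in \mathbb{C}^N$ with the standard inner product. The graph norm of $A_{21}$ is $\|u\|_{A_{21}}^2 = \|A_{21}u\|_{H_2}^2 + \|u\|_{H_1}^2$. A measurable set has full measure if its complement is a null set. *)

(* Defs.v *)
From HB Require Import structures.
From mathcomp Require Import all_boot all_order all_algebra.
From mathcomp Require Import complex ring lra.
From mathcomp Require Import all_classical all_reals all_analysis measurable_realfun.
Set Implicit Arguments.
Unset Strict Implicit.
Unset Printing Implicit Defensive.
Import Order.TTheory GRing.Theory Num.Theory.
Import numFieldNormedType.Exports.
Local Open Scope classical_set_scope.
Local Open Scope ring_scope.

(* Complex inner product spaces; the inner product is linear in its first and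
   antilinear in its second argument. *)
HB.mixin Record NormedModule_isPreHilbert (R : realType) H
    & NormedModule R[i] H := {
  ip : H -> H -> R[i] ;
  ip_linearl : forall (a : R[i]) (x y z : H),
    ip (a *: x + y) z = a * ip x z + ip y z ;
  ip_conj : forall x y : H, ip y x = (ip x y)^* ;
  ip_norm : forall x : H, ip x x = `|x| ^+ 2 }.

#[short(type="preHilbertType")]
HB.structure Definition PreHilbert (R : realType) :=
  {H of NormedModule R[i] H & NormedModule_isPreHilbert R H}.

#[short(type="hilbertType")]
HB.structure Definition Hilbert (R : realType) :=
  {H of PreHilbert R H & Complete H}.

HB.factory Record Lmodule_isPreHilbert (R : realType) H
    & GRing.Lmodule R[i] H := {
  ip : H -> H -> R[i] ;
  ip_linearl : forall (a : R[i]) (x y z : H),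
    ip (a *: x + y) z = a * ip x z + ip y z ;
  ip_conj : forall x y : H, ip y x = (ip x y)^* ;
  ip_ge0 : forall x : H, 0 <= ip x x ;
  ip_eq0 : forall x : H, ip x x = 0 -> x = 0 }.

HB.builders Context R H & Lmodule_isPreHilbert R H.

Let norm (x : H) : R[i] := sqrtC (ip x x).

Let ip0l z : ip 0 z = 0.
Proof. by have := ip_linearl (-1) 0 0 z; rewrite scaler0 addr0 mulN1r addNr. Qed.
Let ipDl x y z : ip (x + y) z = ip x z + ip y z.
Proof. by rewrite -[x]scale1r ip_linearl mul1r scale1r. Qed.
Let ipZl a x z : ip (a *: x) z = a * ip x z.
Proof. by rewrite -[a *: x]addr0 ip_linearl ip0l addr0. Qed.
Let ipDr x y z : ip z (x + y) = ip z x + ip z y.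
Proof. by rewrite ip_conj ipDl rmorphD/= -!ip_conj. Qed.
Let ipZr a x z : ip z (a *: x) = a^* * ip z x.
Proof. by rewrite ip_conj ipZl rmorphM/= -!ip_conj. Qed.

Let norm_ge0 x : 0 <= norm x.
Proof. by rewrite sqrtC_ge0 ip_ge0. Qed.

Let norm_sq x : norm x ^+ 2 = ip x x.
Proof. by rewrite sqrtCK. Qed.

Let cauchy_schwarz x y : `|ip x y| <= norm x * norm y.
Proof.
have [y0|y0] := eqVneq (ip y y) 0.
  by rewrite (ip_eq0 y0) [ip x 0]ip_conj ip0l conjC0 normr0 mulr_ge0.
have yy0 : 0 < ip y y by rewrite lt0r y0 ip_ge0.
rewrite -(@ler_pXn2r _ 2)// ?nnegrE ?mulr_ge0//.
rewrite exprMn !norm_sq normCK -subr_ge0.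
have := ip_ge0 (ip y y *: x + (- ip x y) *: y).
have cyy : (ip y y)^* = ip y y by rewrite -ip_conj.
rewrite (_ : ip _ _ = ip y y * (ip y y * ip x x - ip x y * (ip x y)^*)).
  by rewrite pmulr_rge0// (mulrC (ip x x)).
rewrite ipDl !ipDr !ipZl !ipZr cyy rmorphN/= (ip_conj x y).
ring.
Qed.

Let norm_triangle x y : norm (x + y) <= norm x + norm y.
Proof.
rewrite -(@ler_pXn2r _ 2)// ?nnegrE ?addr_ge0// norm_sq sqrrD !norm_sq.
rewrite (_ : ip _ _ = ip x x + 'Re (ip x y) *+ 2 + ip y y); last first.
  rewrite ipDl !ipDr (ip_conj x y) -[_ *+ 2]mulr_natr ReE mulfVK ?pnatr_eq0//.
  by ring.
rewrite lerD2r lerD2l ler_wMn2r//.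
by apply: le_trans (cauchy_schwarz x y); rewrite leif_Re_Creal.
Qed.

Let normZ (l : R[i]) x : norm (l *: x) = `|l| * norm x.
Proof.
apply/eqP; rewrite -(@eqrXn2 _ 2)// ?mulr_ge0// exprMn !norm_sq ipZl ipZr normCK.
by rewrite mulrA.
Qed.

Let norm_eq0 x : norm x = 0 -> x = 0.
Proof. by move=> /eqP; rewrite sqrtC_eq0 => /eqP/ip_eq0. Qed.

HB.instance Definition _ :=
  @Lmodule_isNormed.Build R[i] H norm norm_triangle normZ norm_eq0.

Let ip_norm x : ip x x = `|x| ^+ 2. Proof. by rewrite -norm_sq. Qed.

HB.instance Definition _ :=
  @NormedModule_isPreHilbert.Build R H ip ip_linearl ip_conj ip_norm.
HB.end.
(* H^N with the inner product of the Hilbert direct sum, see [hpow_ipE]. *)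
Definition hpow (N : nat) (H : Type) := {ffun 'I_N -> H}.

Section HPow.
Context (R : realType) (N : nat) (H : preHilbertType R).

HB.instance Definition _ := GRing.Lmodule.on (hpow N H).

Let pip (u v : hpow N H) : R[i] := \sum_(k < N) ip (u k) (v k).

Let pip_linearl (a : R[i]) (x y z : hpow N H) :
  pip (a *: x + y) z = a * pip x z + pip y z.
Proof.
rewrite /pip mulr_sumr -big_split/=; apply: eq_bigr => k _.
by rewrite !ffunE ip_linearl.
Qed.

Let pip_conj (x y : hpow N H) : pip y x = (pip x y)^*.
Proof. by rewrite /pip rmorph_sum/=; apply: eq_bigr => k _; rewrite ip_conj. Qed.

Let ipxx_ge0 (x : H) : 0 <= ip x x.
Proof. by rewrite ip_norm exprn_ge0. Qed.

Let pip_ge0 (x : hpow N H) : 0 <= pip x x.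
Proof. by apply: sumr_ge0 => k _. Qed.

Let pip_eq0 (x : hpow N H) : pip x x = 0 -> x = 0.
Proof.
move=> /eqP; rewrite psumr_eq0// => /allP x0; apply/ffunP => k; rewrite ffunE.
have := x0 k; rewrite mem_index_enum => /(_ isT)/=.
by rewrite ip_norm sqrf_eq0 normr_eq0 => /eqP.
Qed.

HB.instance Definition _ :=
  Lmodule_isPreHilbert.Build R (hpow N H) pip_linearl pip_conj pip_ge0 pip_eq0.

Lemma hpow_ipE (u v : hpow N H) : ip u v = \sum_(k < N) ip (u k) (v k).
Proof. by []. Qed.

End HPow.

Section ComplexFunctions.
Context (d : measure_display) (T : measurableType d) (R : realType).
Implicit Types f g : T -> R[i].

Definition cmeasurable f :=
  measurable_fun setT (fun x => complex.Re (f x)) /\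
  measurable_fun setT (fun x => complex.Im (f x)).

Lemma cmeasurable_cst (c : R[i]) : cmeasurable (fun=> c).
Proof. by split; exact: measurable_cst. Qed.

Lemma cmeasurableD f g : cmeasurable f -> cmeasurable g ->
  cmeasurable (fun x => f x + g x).
Proof.
move=> [f1 f2] [g1 g2]; split.
- rewrite (_ : (fun _ => _) = (fun x => complex.Re (f x) + complex.Re (g x))).
    exact: measurable_funD.
  by apply/funext => x; rewrite raddfD.
- rewrite (_ : (fun _ => _) = (fun x => complex.Im (f x) + complex.Im (g x))).
    exact: measurable_funD.
  by apply/funext => x; rewrite raddfD.
Qed.

Lemma ReD (a b : R[i]) : complex.Re (a + b) = complex.Re a + complex.Re b.
Proof. by case: a b => [? ?] [? ?]. Qed.

Lemma ImD (a b : R[i]) : complex.Im (a + b) = complex.Im a + complex.Im b.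
Proof. by case: a b => [? ?] [? ?]. Qed.

Lemma ReM (a b : R[i]) : complex.Re (a * b) =
  complex.Re a * complex.Re b - complex.Im a * complex.Im b.
Proof. by case: a b => [? ?] [? ?]. Qed.

Lemma ImM (a b : R[i]) : complex.Im (a * b) =
  complex.Re a * complex.Im b + complex.Im a * complex.Re b.
Proof. by case: a b => [? ?] [? ?]. Qed.

Lemma ReJ (a : R[i]) : complex.Re a^* = complex.Re a.
Proof. by case: a. Qed.

Lemma ImJ (a : R[i]) : complex.Im a^* = - complex.Im a.
Proof. by case: a. Qed.

Lemma cmeasurableM f g : cmeasurable f -> cmeasurable g ->
  cmeasurable (fun x => f x * g x).
Proof.
move=> [f1 f2] [g1 g2]; split.
- under eq_fun do rewrite ReM.
  by apply: measurable_funB; apply: measurable_funM.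
- under eq_fun do rewrite ImM.
  by apply: measurable_funD; apply: measurable_funM.
Qed.

Lemma cmeasurableJ f : cmeasurable f -> cmeasurable (fun x => (f x)^*).
Proof.
move=> [f1 f2]; split; first by under eq_fun do rewrite ReJ.
by under eq_fun do rewrite ImJ; apply: measurableT_comp.
Qed.

Lemma normc_sqr (z : R[i]) :
  Normc.normc z ^+ 2 = complex.Re z ^+ 2 + complex.Im z ^+ 2.
Proof. by case: z => a b /=; rewrite sqr_sqrtr// addr_ge0// sqr_ge0. Qed.

Lemma cmeasurable_normc_sqr f : cmeasurable f ->
  measurable_fun setT (fun x => Normc.normc (f x) ^+ 2).
Proof.
move=> [f1 f2]; under eq_fun do rewrite normc_sqr.
by apply: measurable_funD; exact: measurable_funX.
Qed.

End ComplexFunctions.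

Section SquareIntegrable.
Context (d : measure_display) (T : measurableType d) (R : realType).
Variable mu : {measure set T -> \bar R}.
Implicit Types f g : T -> R[i].

Definition cintegral f : R[i] :=
  ((\int[mu]_x complex.Re (f x)) +i* (\int[mu]_x complex.Im (f x)))%C.

Definition square_integrable f :=
  cmeasurable f /\ mu.-integrable setT (EFin \o (fun x => Normc.normc (f x) ^+ 2)).

Lemma sqint_le f (h : T -> R) : cmeasurable f ->
  mu.-integrable setT (EFin \o h) ->
  (forall x, Normc.normc (f x) ^+ 2 <= h x) -> square_integrable f.
Proof.
move=> mf ih fh; split=> //; apply: le_integrable ih => //=.
  by apply/measurable_EFinP; exact: cmeasurable_normc_sqr.
move=> x _; rewrite lee_fin [leLHS]ger0_norm ?sqr_ge0//.
by rewrite (le_trans (fh x))// ler_norm.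
Qed.

Lemma sqint0 : square_integrable (fun=> 0).
Proof.
apply: (@sqint_le _ (fun=> 0)); first exact: cmeasurable_cst.
- by rewrite (_ : EFin \o _ = cst 0%E)//; exact: integrable0.
- by move=> x; rewrite normc_sqr/= expr0n/= addr0.
Qed.

Lemma sqintD (a : R[i]) f g : square_integrable f -> square_integrable g ->
  square_integrable (fun x => a * f x + g x).
Proof.
move=> [mf jf] [mg jg].
pose h x := (2 * Normc.normc a ^+ 2) * Normc.normc (f x) ^+ 2 +
  2 * Normc.normc (g x) ^+ 2.
apply: (@sqint_le _ h).
- by apply: cmeasurableD => //; apply: cmeasurableM => //; exact: cmeasurable_cst.
- have := integrableD measurableT
    (integrableZl measurableT (2 * Normc.normc a ^+ 2) jf)
    (integrableZl measurableT 2 jg).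
  by congr (_.-integrable _ _).
- move=> x; rewrite /h !normc_sqr raddfD/= (raddfD (@complex.Im R))/=.
  rewrite !ReM !ImM.
  set a1 := complex.Re a; set a2 := complex.Im a.
  set b1 := complex.Re (f x); set b2 := complex.Im (f x).
  set c1 := complex.Re (g x); set c2 := complex.Im (g x).
  rewrite -subr_ge0.
  rewrite [X in 0 <= X](_ : _ = (a1 * b1 - a2 * b2 - c1) ^+ 2 + (a1 * b2 + a2 * b1 - c2) ^+ 2); last by ring.
  by rewrite addr_ge0// sqr_ge0.
Qed.

Let le_prod (a b c e : R) (s : R) : s ^+ 2 = 1 ->
  `|a * b + s * (c * e)| <= a ^+ 2 + c ^+ 2 + (b ^+ 2 + e ^+ 2).
Proof.
move=> s1; rewrite ler_norml; apply/andP; split; rewrite -subr_ge0.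
  rewrite [X in 0 <= X](_ : _ = 2^-1 * ((a + b) ^+ 2 + (c + s * e) ^+ 2 +
   a ^+ 2 + c ^+ 2 + (b ^+ 2 + e ^+ 2)) + 2^-1 * (1 - s ^+ 2) * e ^+ 2); last by field.
  by rewrite s1 subrr mulr0 mul0r addr0 mulr_ge0// ?invr_ge0// !addr_ge0// sqr_ge0.
rewrite [X in 0 <= X](_ : _ = 2^-1 * ((a - b) ^+ 2 + (c - s * e) ^+ 2 +
   a ^+ 2 + c ^+ 2 + (b ^+ 2 + e ^+ 2)) + 2^-1 * (1 - s ^+ 2) * e ^+ 2); last by field.
by rewrite s1 subrr mulr0 mul0r addr0 mulr_ge0// ?invr_ge0// !addr_ge0// sqr_ge0.
Qed.

Lemma sqintM f g : square_integrable f -> square_integrable g ->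
  mu.-integrable setT (EFin \o (fun x => complex.Re (f x * (g x)^*))) /\
  mu.-integrable setT (EFin \o (fun x => complex.Im (f x * (g x)^*))).
Proof.
move=> [mf jf] [mg jg].
have [m1 m2] := cmeasurableM mf (cmeasurableJ mg).
have := integrableD measurableT jf jg => jfg.
split; apply: le_integrable jfg => //; try exact/measurable_EFinP.
- move=> x _ /=; rewrite lee_fin !normc_sqr [leRHS]ger0_norm ?addr_ge0 ?sqr_ge0//.
  rewrite ReM ReJ ImJ mulrN opprK.
  have := @le_prod (complex.Re (f x)) (complex.Re (g x)) (complex.Im (f x))
    (complex.Im (g x)) 1 (expr1n _ _).
  by rewrite mul1r.
- move=> x _ /=; rewrite lee_fin !normc_sqr [leRHS]ger0_norm ?addr_ge0 ?sqr_ge0//.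
  have := @le_prod (complex.Im (f x)) (complex.Re (g x)) (complex.Re (f x))
    (complex.Im (g x)) (-1) (etrans (sqrrN 1) (expr1n _ _)).
  by rewrite ImM ReJ ImJ mulrN mulN1r (addrC (- _)) (addrC (complex.Im (f x) ^+ 2)).
Qed.

Lemma eq_cintegral f g : cmeasurable f -> cmeasurable g ->
  {ae mu, forall x, f x = g x} -> cintegral f = cintegral g.
Proof.
move=> [f1 f2] [g1 g2] fg; rewrite /cintegral; congr (_ +i* _)%C; congr fine;
  (apply: ae_eq_integral => //; [exact/measurable_EFinP|exact/measurable_EFinP|]);
  by apply: filterS fg => x -> _.
Qed.

Let Rintegral_lin (a b : R) (F G K : T -> R) :
  mu.-integrable setT (EFin \o F) -> mu.-integrable setT (EFin \o G) ->
  mu.-integrable setT (EFin \o K) ->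
  \int[mu]_x (a * F x + b * G x + K x) =
  a * \int[mu]_x F x + b * \int[mu]_x G x + \int[mu]_x K x.
Proof.
move=> iF iG iK.
have iaF : mu.-integrable setT (EFin \o (fun x => a * F x)).
  by have := integrableZl measurableT a iF; congr (_.-integrable _ _).
have ibG : mu.-integrable setT (EFin \o (fun x => b * G x)).
  by have := integrableZl measurableT b iG; congr (_.-integrable _ _).
have iaFbG : mu.-integrable setT (EFin \o (fun x => a * F x + b * G x)).
  by have := integrableD measurableT iaF ibG; congr (_.-integrable _ _).
by rewrite !RintegralD// !RintegralZl.
Qed.

Let cintegral_lin (a : R[i]) (F G : T -> R[i]) :
  mu.-integrable setT (EFin \o (fun x => complex.Re (F x))) ->
  mu.-integrable setT (EFin \o (fun x => complex.Im (F x))) ->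
  mu.-integrable setT (EFin \o (fun x => complex.Re (G x))) ->
  mu.-integrable setT (EFin \o (fun x => complex.Im (G x))) ->
  cintegral (fun x => a * F x + G x) = a * cintegral F + cintegral G.
Proof.
move=> F1 F2 G1 G2; apply/eqP; rewrite eq_complex; apply/andP; split; apply/eqP.
- rewrite ReD ReM /cintegral/= -mulNr -Rintegral_lin//.
  by apply: eq_Rintegral => x _; rewrite ReD ReM mulNr.
- rewrite ImD ImM /cintegral/= -Rintegral_lin//.
    by apply: eq_Rintegral => x _; rewrite ImD ImM.
Qed.

Definition sqint_pred : {pred T -> R[i]} := mem [set f | square_integrable f].

Lemma sqint_submod_closed : submod_closed sqint_pred.
Proof.
split; first by rewrite inE; exact: sqint0.
by move=> a f g; rewrite !inE => sf sg; exact: sqintD.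
Qed.

HB.instance Definition _ := GRing.isSubmodClosed.Build R[i] (T -> R[i]) sqint_pred
  sqint_submod_closed.

Record L2fun := MkL2fun { L2val :> T -> R[i] ; L2valP : L2val \in sqint_pred }.

HB.instance Definition _ := [isSub for L2val].
HB.instance Definition _ := [Choice of L2fun by <:].
HB.instance Definition _ := [SubChoice_isSubLmodule of L2fun by <:].

Lemma L2funP (f : L2fun) : square_integrable f.
Proof. by have := L2valP f; rewrite inE. Qed.

Definition null_pred : {pred L2fun} := mem [set f : L2fun | {ae mu, forall x, f x = 0}].

Lemma null_zmod_closed : zmod_closed null_pred.
Proof.
split; first by rewrite inE; exact: aeW.
move=> f g; rewrite !inE /=; apply: filterS2 => x /= f0 g0.
by rewrite -[RHS](subrr 0) -{1}f0 -g0.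
Qed.

HB.instance Definition _ := GRing.isZmodClosed.Build L2fun null_pred null_zmod_closed.

(* Square integrable complex functions modulo almost everywhere equality; [repr]
   picks a representative. *)
Definition L2 := Quotient.quot null_pred.

HB.instance Definition _ := GRing.Zmodule.on L2.
HB.instance Definition _ : EqQuotient L2fun (Quotient.equiv null_pred) L2 :=
  EqQuotient.on L2.


Let pi (f : L2fun) : L2 := (\pi_L2 f)%qT.

Let piE (f g : L2fun) : pi f = pi g <-> {ae mu, forall x, f x = g x}.
Proof.
have -> : {ae mu, forall x, f x = g x} = (f - g \in null_pred).
  rewrite inE/=; apply/propext; split; apply: filterS => x.
    by move=> fg; rewrite -[RHS](subrr (g x)) -{1}fg.
  by move=> fg; apply/eqP; rewrite -subr_eq0; apply/eqP.
by rewrite Quotient.idealrBE; split=> [/eqP|/eqP].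
Qed.

Let repr_pi (f : L2fun) : {ae mu, forall x, repr (pi f) x = f x}.
Proof. by apply/piE; rewrite /pi reprK. Qed.

Let piD (f g : L2fun) : pi (f + g) = pi f + pi g.
Proof. exact: (raddfD \pi_L2%qT). Qed.

Let scale (a : R[i]) (u : L2) : L2 := pi (a *: repr u).

Let scale_pi a (f : L2fun) : scale a (pi f) = pi (a *: f).
Proof.
by apply/piE; apply: filterS (repr_pi f) => x fx; congr (a * _).
Qed.

Let scalerA a b u : scale a (scale b u) = scale (a * b) u.
Proof. by rewrite {2}/scale scale_pi scalerA. Qed.

Let scale1r : left_id 1 scale.
Proof. by move=> u; rewrite /scale scale1r /pi reprK. Qed.

Let scalerDr : right_distributive scale +%R.
Proof.
move=> a u v; rewrite -[u]reprK -[v]reprK -!/(pi _).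
by rewrite -piD !scale_pi scalerDr piD.
Qed.

Let scalerDl u : {morph scale^~ u : a b / a + b}.
Proof. by move=> a b; rewrite /scale scalerDl piD. Qed.

HB.instance Definition _ :=
  GRing.Zmodule_isLmodule.Build R[i] L2 scalerA scale1r scalerDr scalerDl.

Lemma L2_addE (u v : L2) :
  {ae mu, forall x, repr (u + v) x = repr u x + repr v x}.
Proof.
have -> : u + v = pi (repr u + repr v) by rewrite piD /pi !reprK.
exact: repr_pi.
Qed.

Lemma L2_scaleE a (u : L2) : {ae mu, forall x, repr (a *: u) x = a * repr u x}.
Proof. exact: repr_pi. Qed.

Lemma L2_eqP (u v : L2) : u = v <-> {ae mu, forall x, repr u x = repr v x}.
Proof. by rewrite -piE /pi !reprK. Qed.

(* The class of f, with junk value 0 when f is not square integrable. *)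
Definition L2_of f : L2 :=
  if pselect (f \in sqint_pred) is left sf then (\pi_L2 (MkL2fun sf))%qT else 0.

Lemma L2_ofE f : square_integrable f ->
  {ae mu, forall x, repr (L2_of f) x = f x}.
Proof.
move=> sf; rewrite /L2_of; case: pselect => [sf'|]; last by rewrite inE.
exact: (repr_pi (MkL2fun sf')).
Qed.

Let L2ip (u v : L2) : R[i] := cintegral (fun x => repr u x * (repr v x)^*).

Let cmeas_ip (f g : L2fun) : cmeasurable (fun x => f x * (g x)^*).
Proof.
have [[mf _] [mg _]] := (L2funP f, L2funP g).
by apply: cmeasurableM => //; exact: cmeasurableJ.
Qed.

Let L2ip_linearl (a : R[i]) (x y z : L2) :
  L2ip (a *: x + y) z = a * L2ip x z + L2ip y z.
Proof.
pose f t : R[i] := a * (repr x t * (repr z t)^*) + repr y t * (repr z t)^*.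
have [xz1 xz2] := sqintM (L2funP (repr x)) (L2funP (repr z)).
have [yz1 yz2] := sqintM (L2funP (repr y)) (L2funP (repr z)).
rewrite /L2ip (@eq_cintegral _ f) ; [|exact: cmeas_ip| |]; last 2 first.
- apply: cmeasurableD; last exact: cmeas_ip.
  by apply: cmeasurableM; [exact: cmeasurable_cst|exact: cmeas_ip].
- apply: filterS2 (L2_addE (a *: x) y) (L2_scaleE a x) => t -> ->.
  by rewrite /f mulrDl mulrA.
exact: cintegral_lin.
Qed.

Let L2ip_conj (x y : L2) : L2ip y x = (L2ip x y)^*.
Proof.
have [xz1 xz2] := sqintM (L2funP (repr x)) (L2funP (repr y)).
apply/eqP; rewrite eq_complex ReJ ImJ /L2ip /cintegral/=; apply/andP; split; apply/eqP.
- by apply: eq_Rintegral => t _; rewrite !ReM !ReJ !ImJ; ring.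
- rewrite -mulN1r -RintegralZl//.
  by apply: eq_Rintegral => t _; rewrite !ImM !ReJ !ImJ; ring.
Qed.

Let L2ip_xx (x : L2) :
  L2ip x x = (\int[mu]_t (Normc.normc (repr x t) ^+ 2))%:C%C.
Proof.
apply/eqP; rewrite eq_complex /L2ip /cintegral/=; apply/andP; split; apply/eqP.
- by apply: eq_Rintegral => t _; rewrite normc_sqr ReM ReJ ImJ; ring.
- transitivity (\int[mu]_t (0 : R)).
    by apply: eq_Rintegral => t _; rewrite ImM ReJ ImJ; ring.
  by rewrite Rintegral_cst// mul0r.
Qed.

Let L2ip_ge0 (x : L2) : 0 <= L2ip x x.
Proof. by rewrite L2ip_xx ler0c Rintegral_ge0// => t _; exact: sqr_ge0. Qed.

Let L2ip_eq0 (x : L2) : L2ip x x = 0 -> x = 0.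
Proof.
have [mx ix] := L2funP (repr x).
rewrite L2ip_xx => -[] x0.
have i0 : (\int[mu]_t `|(Normc.normc (repr x t) ^+ 2)%:E| = 0)%E.
  under eq_integral do rewrite gee0_abs ?lee_fin ?sqr_ge0//.
  rewrite -[LHS]fineK; first by congr EFin.
  exact: integrable_fin_num ix.
have mx2 : measurable_fun setT (EFin \o (fun t => Normc.normc (repr x t) ^+ 2)).
  by apply/measurable_EFinP; exact: cmeasurable_normc_sqr.
have h := (ae_eq_integral_abs mu measurableT mx2).1 i0.
have {}h : {ae mu, forall t, repr x t = 0}.
  apply: filterS h => t.
  by move=> /(_ I)/= [] /eqP; rewrite sqrf_eq0 => /eqP /Normc.eq0_normc.
rewrite -[x]reprK -!/(pi _) -(_ : pi 0 = 0); last exact: (raddf0 \pi_L2%qT).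
by apply/piE.
Qed.

HB.instance Definition _ :=
  Lmodule_isPreHilbert.Build R L2 L2ip_linearl L2ip_conj L2ip_ge0 L2ip_eq0.

Lemma L2_ipE (u v : L2) : ip u v = cintegral (fun x => repr u x * (repr v x)^*).
Proof. by []. Qed.

End SquareIntegrable.

Section Operators.
Context (R : realType).

(* Unbounded operators; the values of [op_fun] outside [dom] are irrelevant. *)
Record operator (U V : Type) := Operator { dom : set U ; op_fun :> U -> V }.

(* The library norm on a module over R[i] takes its values in R[i]. *)
Definition hnorm (H : normedModType R[i]) (x : H) : R := complex.Re `|x|.

Section General.
Context (U V : preHilbertType R).
Implicit Type A : operator U V.

Definition linear_operator A :=
  dom A 0 /\ forall (a : R[i]) (x y : U), dom A x -> dom A y ->
    dom A (a *: x + y) /\ A (a *: x + y) = a *: A x + A y.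

Definition closed_operator A :=
  closed [set p : U * V | dom A p.1 /\ A p.1 = p.2].

Definition densely_defined A := dense (dom A).

Definition operator_kernel A := [set x | dom A x /\ A x = 0].

Definition adjoint_pair A (y : V) (z : U) :=
  forall x, dom A x -> ip (A x) y = ip x z.

(* When A is densely defined there is at most one z with adjoint_pair A y z. *)
Definition adjoint A : operator V U :=
  Operator [set y | exists z, adjoint_pair A y z]
           (fun y => xget 0 [set z | adjoint_pair A y z]).

Definition graph_norm A (x : U) : R :=
  Num.sqrt (hnorm (A x) ^+ 2 + hnorm x ^+ 2).

Definition compactly_embedded A :=
  forall r : R, precompact [set x | dom A x /\ graph_norm A x <= r].

Definition bounded_operator (f : U -> V) :=
  exists M : R, forall x, hnorm (f x) <= M * hnorm x.

Definition op_norm (f : U -> V) : \bar R :=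
  ereal_sup [set (hnorm (f x))%:E | x in [set x | hnorm x <= 1]].

End General.

(* - A^* S A with its maximal domain. *)
Definition sandwich (U V : preHilbertType R) (A : operator U V) (S : V -> V) :
    operator U U :=
  Operator [set x | dom A x /\ dom (adjoint A) (S (A x))]
           (fun x => - adjoint A (S (A x))).

Definition op_eigenvalue (U : preHilbertType R) (A : operator U U) (l : R[i]) :=
  exists x, [/\ dom A x, x != 0 & A x = l *: x].

Section Semigroups.
Context (X : preHilbertType R).
Implicit Type T : R -> {linear X -> X}.

(* Only the values T t with 0 <= t matter. *)
Definition C0_semigroup T :=
  [/\ forall t, 0 <= t -> bounded_operator (T t),
      forall x, T 0 x = x,
      forall s t x, 0 <= s -> 0 <= t -> T (s + t) x = T s (T t x)
    & forall x, T t x @[t --> 0^'+] --> x].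

Definition generator T : operator X X :=
  let quotient x := fun t : R => (t^-1)%:C%C *: (T t x - x) in
  Operator [set x | cvg (quotient x t @[t --> 0^'+])]
           (fun x => lim (quotient x t @[t --> 0^'+])).

Definition generates (A : operator X X) T :=
  dom (generator T) = dom A /\ forall x, dom A x -> generator T x = A x.

Definition converges_in_op_norm T :=
  exists2 P : {linear X -> X}, bounded_operator P &
    op_norm (fun x => T t x - P x) @[t --> +oo%R] --> 0%E.

End Semigroups.

End Operators.

Section MatrixPotential.
Context (d : measure_display) (Omega : measurableType d) (R : realType).
Variable mu : {measure set Omega -> \bar R}.
Context (N : nat).
Implicit Type V : Omega -> 'M[R[i]]_N.

Definition measurable_mx V := forall k j, cmeasurable (fun x => V x k j).

Definition ess_bounded_mx V :=
  exists M : R, {ae mu, forall x, forall k j, Normc.normc (V x k j) <= M}.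

Definition dissipative_mx (M : 'M[R[i]]_N) :=
  forall xi : 'cV[R[i]]_N,
    complex.Re (\sum_(k < N) (M *m xi) k 0 * (xi k 0)^*) <= 0.

(* [L2_of f] is the class of f only for square integrable f; this holds here
   as soon as V is measurable and essentially bounded, see [mulopE]. *)
Definition mulop V (u : hpow N (L2 mu)) : hpow N (L2 mu) :=
  [ffun k => L2_of mu (fun x => \sum_(j < N) V x k j * repr (u j) x)].

Lemma sqintMb (f g : Omega -> R[i]) (M : R) : cmeasurable f ->
  {ae mu, forall x, Normc.normc (f x) <= M} -> square_integrable mu g ->
  square_integrable mu (fun x => f x * g x).
Proof.
move=> mf fM [mg ig]; have mfg := cmeasurableM mf mg; split => //.
have mh : measurable_fun setT
    (EFin \o (fun x => Normc.normc (f x * g x) ^+ 2)).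
  by apply/measurable_EFinP; exact: cmeasurable_normc_sqr.
apply/integrableP; split => //.
have /integrableP[mG iG] := integrableZl measurableT (M ^+ 2) ig.
apply: le_lt_trans iG; apply: ae_ge0_le_integral => //.
- exact: measurableT_comp.
- exact: measurableT_comp.
- apply: filterS fM => x fxM _.
  have n0 (z : R[i]) : 0 <= Normc.normc z by case: z => ? ? /=; exact: sqrtr_ge0.
  rewrite -[leRHS]/(`|(M ^+ 2 * Normc.normc (g x) ^+ 2)%:E|%E).
  rewrite -[leLHS]/(`|(Normc.normc (f x * g x) ^+ 2)%:E|%E).
  have g0 := mulr_ge0 (sqr_ge0 M) (sqr_ge0 (Normc.normc (g x))).
  rewrite !gee0_abs ?lee_fin ?sqr_ge0//.
  have M0 := le_trans (n0 (f x)) fxM.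
  have -> : Normc.normc (f x * g x) = Normc.normc (f x) * Normc.normc (g x).
    exact: Normc.normcM.
  by rewrite exprMn ler_wpM2r ?sqr_ge0// lerXn2r ?nnegrE.
Qed.

Lemma mulopE V (u : hpow N (L2 mu)) (k : 'I_N) :
  measurable_mx V -> ess_bounded_mx V ->
  {ae mu, forall x,
    repr (mulop V u k) x = \sum_(j < N) V x k j * repr (u j) x}.
Proof.
move=> mV [M VM]; rewrite ffunE; apply: L2_ofE.
rewrite (_ : (fun _ => _) = \sum_(j < N) (fun x => V x k j * repr (u j) x)).
  suff : \sum_(j < N) (fun x => V x k j * repr (u j) x) \in sqint_pred mu.
    by rewrite inE.
  apply: rpred_sum => j _; rewrite inE; apply: (@sqintMb _ _ M).
  - exact: mV.
  - by apply: filterS VM => x; exact.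
  - exact: L2funP.
by apply/funext => x; rewrite fct_sumE.
Qed.

Definition diag_operator (H : preHilbertType R) (A : 'I_N -> operator H H) :
    operator (hpow N H) (hpow N H) :=
  Operator [set u : hpow N H | forall k, dom (A k) (u k)]
           (fun u : hpow N H => [ffun k => A k (u k)] : hpow N H).

Definition coupled_operator (H2 : preHilbertType R)
    (A21 : operator (L2 mu) H2) (S : 'I_N -> H2 -> H2) V :
    operator (hpow N (L2 mu)) (hpow N (L2 mu)) :=
  let A := diag_operator (fun k => sandwich A21 (S k)) in
  Operator (dom A) (fun u => A u + mulop V u).

End MatrixPotential.

(* Main.v *)
From HB Require Import structures.
Require Import Defs.
From mathcomp Require Import all_boot all_order all_algebra.
From mathcomp Require Import complex ring lra.
From mathcomp Require Import all_classical all_reals all_analysis.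
From mathcomp Require Import measurable_realfun.
Set Implicit Arguments.
Unset Strict Implicit.
Unset Printing Implicit Defensive.
Import Order.TTheory GRing.Theory Num.Theory.
Import numFieldNormedType.Exports.
Local Open Scope classical_set_scope.
Local Open Scope ring_scope.

(** Why the theorem holds.

    Eigenvalues.  If [C u = i beta u], then the real part of [ip (C u) u]
    vanishes.  The differential part contributes at most
    [- nu * \sum_k |A21 (u k)|^2] to it, and the potential a nonpositive
    amount ([coupled_dissipative]).  Hence [A21 (u k) = 0] for all [k], so that
    [u] is a constant vector [c] times [w], and on such vectors [C] is
    multiplication by [V].  As [w] vanishes almost nowhere, it can be cancelled:
    [c] lies in the kernel of [i beta - V x] for almost every [x].  Conversely,
    such a [c] makes [c w] an eigenvector ([eigenvalue_common_kernel]).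

    Convergence without imaginary eigenvalues.  The same computation along an
    orbit bounds the loss of [|T t x|^2] from below by a multiple of the time integral
    of [|A21 (T t x)|^2].  So [T] is contractive, and an orbit that loses little
    norm passes through points at which [A21] is small; by the compact
    embedding, such points accumulate at the space [E] of the vectors [c w]
    ([coupled_compact]).  Let [F] be the space of the vectors fixed by [T].  As
    [T] is contractive, it preserves the orthogonal complement of [F]
    ([fixed_ip]).  If no [T t] had norm less than 1 there, a limit point would
    provide a unit vector [y] orthogonal to [F] such that [|T t y| = 1] for all
    [t].  But the vectors of conserved norm form an invariant subspace of the
    finite dimensional space [E] on which the generator is skew, and a skew
    operator without nonzero eigenvalues is zero there ([conserved_kernel]); so
    [y] is fixed, a contradiction ([uniform_decay]).  Therefore the norm of
    [T t] on the complement of [F] decays geometrically, and [T t] converges to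
    the orthogonal projection onto [F] ([decay_converges]).

    Convergence excludes imaginary eigenvalues.  The limit [P] satisfies
    [P (T t x) = P x], hence [P (C x) = 0], so [P x = 0] for an eigenvector [x]
    with eigenvalue [i beta <> 0].  But [|T t x|] is constant along its orbit
    ([convergent_no_imaginary_eigenvalue]).

    The analysis behind this.  Orbits are continuous because Baire's theorem on
    the time axis makes the semigroup locally bounded ([locally_bounded]); a
    continuous function with controlled right increments is then controlled
    globally ([right_increment_le]), which replaces integration of orbits.  The
    subspaces onto which one projects are complete because bounded sequences in
    the graph of [A21] accumulate ([graph_complete], [fixed_complete]); on the
    graph, the Lax-Milgram theorem ([lax_milgram]) produces enough elements of
    the domain of [A21^* S A21] to make it dense ([sandwich_dense]). *)

(** * Inner product spaces *)

Section PreHilbertTheory.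
Context (R : realType) (H : preHilbertType R).
Implicit Types (x y z : H) (a : R[i]).

Lemma hnormE x : `|x| = (hnorm x)%:C%C.
Proof. by rewrite /hnorm RRe_real// ger0_real. Qed.

Lemma hnorm_ge0 x : 0 <= hnorm x.
Proof. by rewrite -ler0c -hnormE. Qed.

Lemma hnorm0 : hnorm (0 : H) = 0.
Proof. by apply: complexI; rewrite -hnormE normr0. Qed.

Lemma hnorm0_eq0 x : hnorm x = 0 -> x = 0.
Proof. by move=> x0; apply/eqP; rewrite -normr_eq0 hnormE x0. Qed.

Lemma hnormN x : hnorm (- x) = hnorm x.
Proof. by rewrite /hnorm normrN. Qed.

Lemma hdistC x y : hnorm (x - y) = hnorm (y - x).
Proof. by rewrite -hnormN opprB. Qed.

Lemma ler_hnormD x y : hnorm (x + y) <= hnorm x + hnorm y.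
Proof. by rewrite -lecR rmorphD/= -!hnormE ler_normD. Qed.

Lemma ler_hdistD z x y : hnorm (x - y) <= hnorm (x - z) + hnorm (z - y).
Proof. by have := ler_hnormD (x - z) (z - y); rewrite addrA subrK. Qed.

Lemma hnormZ a x : hnorm (a *: x) = Normc.normc a * hnorm x.
Proof. by apply: complexI; rewrite -hnormE normrZ rmorphM/= -hnormE. Qed.

Lemma ler_dist_hnorm x y : `|hnorm x - hnorm y| <= hnorm (x - y).
Proof.
have h (u v : H) : hnorm u - hnorm v <= hnorm (u - v).
  by have := ler_hnormD (u - v) v; rewrite subrK lerBlDr.
by rewrite ler_norml h andbT lerNl opprB hdistC h.
Qed.

Lemma ipDl x y z : ip (x + y) z = ip x z + ip y z.
Proof. by rewrite -[x]scale1r ip_linearl mul1r scale1r. Qed.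

Lemma ip0l z : ip 0 z = 0.
Proof. by have := ip_linearl (-1) 0 0 z; rewrite scaler0 addr0 mulN1r addNr. Qed.

Lemma ipZl a x z : ip (a *: x) z = a * ip x z.
Proof. by rewrite -[a *: x]addr0 ip_linearl ip0l addr0. Qed.

Lemma ipNl x z : ip (- x) z = - ip x z.
Proof. by rewrite -scaleN1r ipZl mulN1r. Qed.

Lemma ipBl x y z : ip (x - y) z = ip x z - ip y z.
Proof. by rewrite ipDl ipNl. Qed.

Lemma ip0r z : ip z 0 = 0.
Proof. by rewrite ip_conj ip0l rmorph0. Qed.

Lemma ipDr x y z : ip z (x + y) = ip z x + ip z y.
Proof. by rewrite ip_conj ipDl rmorphD/= -!ip_conj. Qed.

Lemma ipZr a x z : ip z (a *: x) = a^* * ip z x.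
Proof. by rewrite ip_conj ipZl rmorphM/= -!ip_conj. Qed.

Lemma ipNr x z : ip z (- x) = - ip z x.
Proof. by rewrite ip_conj ipNl rmorphN/= -ip_conj. Qed.

Lemma ipBr x y z : ip z (x - y) = ip z x - ip z y.
Proof. by rewrite ipDr ipNr. Qed.

Lemma ip_eq0C x y : ip x y = 0 -> ip y x = 0.
Proof. by move=> xy; rewrite ip_conj xy rmorph0. Qed.

Definition rip x y : R := complex.Re (ip x y).

Lemma ripxx x : rip x x = hnorm x ^+ 2.
Proof. by apply: complexI; rewrite /rip ip_norm hnormE -rmorphXn. Qed.

Lemma ripC x y : rip x y = rip y x.
Proof. by rewrite /rip ip_conj Defs.ReJ. Qed.

Lemma ripDl x y z : rip (x + y) z = rip x z + rip y z.
Proof. by rewrite /rip ipDl Defs.ReD. Qed.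

Lemma ripNl x z : rip (- x) z = - rip x z.
Proof. by rewrite /rip ipNl raddfN. Qed.

Lemma ripBl x y z : rip (x - y) z = rip x z - rip y z.
Proof. by rewrite ripDl ripNl. Qed.

Lemma ripDr x y z : rip z (x + y) = rip z x + rip z y.
Proof. by rewrite !(ripC z) ripDl. Qed.

Lemma ripNr x z : rip z (- x) = - rip z x.
Proof. by rewrite !(ripC z) ripNl. Qed.

Lemma ripBr x y z : rip z (x - y) = rip z x - rip z y.
Proof. by rewrite ripDr ripNr. Qed.

Lemma ripZl (a : R) x y : rip (a%:C%C *: x) y = a * rip x y.
Proof. by rewrite /rip ipZl Defs.ReM/= mul0r subr0. Qed.

Lemma ripZr (a : R) x y : rip x (a%:C%C *: y) = a * rip x y.
Proof. by rewrite ripC ripZl ripC. Qed.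

Lemma ripZ_self a x : rip (a *: x) x = complex.Re a * hnorm x ^+ 2.
Proof. by rewrite /rip ipZl ip_norm hnormE -rmorphXn Defs.ReM/= mulr0 subr0. Qed.

Lemma hnormD_sqr x y :
  hnorm (x + y) ^+ 2 = hnorm x ^+ 2 + 2 * rip x y + hnorm y ^+ 2.
Proof. by rewrite -!ripxx ripDl !ripDr (ripC y x); ring. Qed.

Lemma hnormB_sqr x y :
  hnorm (x - y) ^+ 2 = hnorm x ^+ 2 - 2 * rip x y + hnorm y ^+ 2.
Proof. by rewrite hnormD_sqr hnormN ripNr mulrN. Qed.

Lemma hnormZR (a : R) x : hnorm (a%:C%C *: x) = `|a| * hnorm x.
Proof. by rewrite hnormZ/= expr0n/= addr0 sqrtr_sqr. Qed.

(** Cauchy-Schwarz: expand the squared norm of [|y|^2 x - rip x y y]. *)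
Lemma ler_norm_rip x y : `|rip x y| <= hnorm x * hnorm y.
Proof.
have [y0|y0] := eqVneq (hnorm y) 0.
  by rewrite (hnorm0_eq0 y0) /rip ip0r normr0 hnorm0 mulr0.
rewrite -(@ler_pXn2r _ 2)// ?nnegrE ?mulr_ge0 ?hnorm_ge0// real_normK ?num_real//.
have := sqr_ge0 (hnorm ((hnorm y ^+ 2)%:C%C *: x - (rip x y)%:C%C *: y)).
rewrite hnormB_sqr ripZl ripZr !hnormZR !exprMn.
rewrite !real_normK ?num_real//.
set p := rip x y; set u := hnorm x; set v := hnorm y => h.
have v0 : 0 < v ^+ 2 by rewrite exprn_even_gt0.
rewrite -subr_ge0 -(pmulr_rge0 _ v0).
by apply: le_trans h _; rewrite le_eqVlt; apply/orP; left; apply/eqP; ring.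
Qed.

Lemma ler_rip x y : rip x y <= hnorm x * hnorm y.
Proof. exact: le_trans (ler_norm _) (ler_norm_rip x y). Qed.

Lemma pythagoras x p : ip (x - p) p = 0 ->
  hnorm x ^+ 2 = hnorm (x - p) ^+ 2 + hnorm p ^+ 2.
Proof.
by move=> xp; have := hnormD_sqr (x - p) p; rewrite subrK /rip xp mulr0 addr0.
Qed.

Lemma hnorm_orth_le x p : ip (x - p) p = 0 -> hnorm p <= hnorm x.
Proof.
move=> /pythagoras xp; rewrite -(@ler_pXn2r _ 2)// ?nnegrE ?hnorm_ge0//.
by rewrite xp lerDr sqr_ge0.
Qed.

Lemma hnorm_orthB_le x p : ip (x - p) p = 0 -> hnorm (x - p) <= hnorm x.
Proof.
move=> /pythagoras xp; rewrite -(@ler_pXn2r _ 2)// ?nnegrE ?hnorm_ge0//.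
by rewrite xp lerDl sqr_ge0.
Qed.

(** The phase [a = ip x y] turns the inner product into its squared modulus,
    so real parts suffice. *)
Lemma ip0P x y : (forall a, rip x (a *: y) = 0) -> ip x y = 0.
Proof.
move=> h; have := h (ip x y); rewrite /rip ipZr mulrC -normCK => h2.
apply/eqP; rewrite -normr_eq0 -sqrf_eq0; apply/eqP.
by rewrite -[LHS](@RRe_real _ (`|ip x y| ^+ 2)) ?ger0_real ?exprn_ge0// h2.
Qed.

(** The norm that defines the filters takes its values in [R[i]]; estimates are
    done with the real norm [hnorm]. *)
Lemma hcvgP T (F : set_system T) {FF : Filter F} (f : T -> H) l :
  f t @[t --> F] --> l <->
  (forall e : R, 0 < e -> \forall t \near F, hnorm (f t - l) < e).
Proof.
split=> [/cvgrPdist_lt h e e0|h].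
  have /h : 0 < e%:C%C :> R[i] by rewrite -[0]/(0%:C%C) ltcR.
  by apply: filterS => t; rewrite hnormE ltcR hdistC.
apply/cvgrPdist_lt => e e0.
have er : e = (complex.Re e)%:C%C by rewrite RRe_real// gtr0_real.
have /h : 0 < complex.Re e by rewrite -ltcR -er.
by apply: filterS => t; rewrite er hnormE ltcR hdistC.
Qed.

Lemma hcvg0 T (F : set_system T) {FF : Filter F} (f : T -> H) l :
  f t @[t --> F] --> l <-> hnorm (f t - l) @[t --> F] --> (0 : R).
Proof.
rewrite hcvgP; split=> [h|/cvgrPdist_lt h e /h].
  apply/cvgrPdist_lt => e /h; apply: filterS => t.
  by rewrite sub0r normrN ger0_norm ?hnorm_ge0.
by apply: filterS => t; rewrite sub0r normrN ger0_norm ?hnorm_ge0.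
Qed.

Lemma cvg_hnorm T (F : set_system T) {FF : Filter F} (f : T -> H) l :
  f t @[t --> F] --> l -> hnorm (f t) @[t --> F] --> hnorm l.
Proof.
move=> /hcvgP h; apply/cvgrPdist_lt => e /h; apply: filterS => t.
by apply: le_lt_trans; rewrite hdistC ler_dist_hnorm.
Qed.

Lemma cvg_rip T (F : set_system T) {FF : Filter F} (f g : T -> H) l m :
  f t @[t --> F] --> l -> g t @[t --> F] --> m ->
  rip (f t) (g t) @[t --> F] --> rip l m.
Proof.
have E x y : rip x y = 2^-1 * (hnorm (x + y) ^+ 2 - hnorm x ^+ 2 - hnorm y ^+ 2).
  by rewrite hnormD_sqr; field.
move=> fl gm; rewrite E; under eq_fun do rewrite E.
apply: cvgM; first exact: cvg_cst.
apply: cvgB; first apply: cvgB; rewrite ?expr2; under eq_fun do rewrite expr2;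
  apply: cvgM; apply: cvg_hnorm => //; exact: cvgD.
Qed.

End PreHilbertTheory.

Section BoundedOperators.
Context (R : realType).

Lemma bounded_le (X Y : preHilbertType R) (f : X -> Y) : bounded_operator f ->
  exists2 M : R, 0 < M & forall x, hnorm (f x) <= M * hnorm x.
Proof.
move=> [M fM]; exists (`|M| + 1); first by rewrite ltr_wpDl.
move=> x; apply: le_trans (fM x) _; apply: ler_wpM2r; first exact: hnorm_ge0.
by apply: le_trans (ler_norm M) _; rewrite lerDl.
Qed.

Lemma bounded_cvg (X Y : preHilbertType R) (f : {linear X -> Y}) T
    (F : set_system T) {FF : Filter F} (u : T -> X) (l : X) :
  bounded_operator f -> u t @[t --> F] --> l -> f (u t) @[t --> F] --> f l.
Proof.
move=> /bounded_le[M M0 fM] /hcvgP ul; apply/hcvgP => e e0.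
have := ul _ (divr_gt0 e0 M0); apply: filterS => t.
rewrite ltr_pdivlMr// => h; rewrite -linearB; apply: le_lt_trans (fM _) _.
by rewrite mulrC.
Qed.

Lemma dense_near (X : preHilbertType R) (D : set X) (x : X)
    (P : X -> Prop) :
  dense D -> (\forall y \near x, P y) -> exists2 y, D y & P y.
Proof.
move=> D_dense /nbhs_ballP[e /= e0 xP].
have [y [xy Dy]] : ball x e `&` D !=set0.
  by apply: D_dense; [exists x; exact: ballxx|exact: ball_open].
by exists y => //; exact: xP.
Qed.

Lemma near_hdist (X : preHilbertType R) (x : X) (e : R) : 0 < e ->
  \forall y \near x, hnorm (y - x) < e.
Proof. by move=> e0; have /hcvgP := @cvg_id _ (nbhs x); apply. Qed.

End BoundedOperators.

(** * Orthogonal projections *)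

Section Projection.
Context (R : realType) (H : preHilbertType R).
Implicit Types (G : set H) (x y g : H).

Definition cauchy_seq (u : nat -> H) := forall e : R, 0 < e ->
  exists n0, forall m n, (n0 <= m)%N -> (n0 <= n)%N -> hnorm (u m - u n) < e.

(** Completeness of a subset inside a space that need not be complete. *)
Definition seq_complete G := forall u : nat -> H, (forall n, G (u n)) ->
  cauchy_seq u -> exists2 l, G l & u n @[n --> \oo] --> l.

Definition linear_subset G :=
  G 0 /\ forall (a : R[i]) x y, G x -> G y -> G (a *: x + y).

Lemma linear_subsetZ G a x : linear_subset G -> G x -> G (a *: x).
Proof. by move=> [G0 GL] Gx; rewrite -[_ *: _]addr0; apply: GL. Qed.

Lemma linear_subsetD G x y : linear_subset G -> G x -> G y -> G (x + y).
Proof. by move=> [G0 GL] Gx Gy; rewrite -[x]scale1r; apply: GL. Qed.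

Lemma linear_subsetB G x y : linear_subset G -> G x -> G y -> G (x - y).
Proof.
by move=> [G0 GL] Gx Gy; rewrite addrC -scaleN1r; apply: GL.
Qed.

(** A first variation argument: moving [p] by [t g] cannot decrease the
    distance to [x]. *)
Lemma closest_ip0 G x p : linear_subset G -> G p ->
  (forall g, G g -> hnorm (x - p) ^+ 2 <= hnorm (x - g) ^+ 2) ->
  forall g, G g -> ip (x - p) g = 0.
Proof.
move=> GL Gp pmin; suff r0 g : G g -> rip (x - p) g = 0.
  by move=> g Gg; apply: ip0P => a; apply: r0; exact: linear_subsetZ.
move=> Gg; set r := rip (x - p) g.
pose s := hnorm g ^+ 2; have s0 : 0 <= s by exact: sqr_ge0.
(* the best step is r / s; s + 1 avoids a division by zero and still wins *)
pose t := r / (s + 1).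
have /pmin : G (p + t%:C%C *: g).
  by apply: linear_subsetD => //; exact: linear_subsetZ.
rewrite opprD addrA (hnormB_sqr (x - p)) ripZr hnormZR exprMn.
rewrite real_normK ?num_real// -/r -/s => h.
have s1 : 0 < s + 1 by rewrite ltr_wpDl.
have {}h : 0 <= - (2 * (t * r)) + t ^+ 2 * s by lra.
have : 0 <= - (r ^+ 2 * (s + 2)).
  rewrite (_ : - _ = (- (2 * (t * r)) + t ^+ 2 * s) * (s + 1) ^+ 2).
    by rewrite mulr_ge0// sqr_ge0.
  by rewrite /t; field; rewrite gt_eqF.
rewrite oppr_ge0 pmulr_lle0 ?ltr_wpDl// => r2.
by apply/eqP; rewrite -sqrf_eq0 eq_le r2 sqr_ge0.
Qed.

Lemma parallelogram x u v : hnorm (u - v) ^+ 2 =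
  2 * hnorm (x - u) ^+ 2 + 2 * hnorm (x - v) ^+ 2
  - 4 * hnorm (x - (2^-1)%:C%C *: (u + v)) ^+ 2.
Proof.
have half : (2^-1)%:C%C + (2^-1)%:C%C = 1 :> R[i].
  by rewrite -rmorphD/= (_ : 2^-1 + 2^-1 = 1 :> R)//; field.
rewrite (_ : u - v = (x - v) - (x - u)); last first.
  by rewrite opprB [RHS]addrC subrKA.
rewrite (_ : x - (2^-1)%:C%C *: (u + v) =
    (2^-1)%:C%C *: ((x - v) + (x - u))); last first.
  rewrite addrACA -opprD scalerBr (addrC v u); congr (_ - _).
  by rewrite scalerDr -scalerDl half scale1r.
move: (x - u) (x - v) => a b.
rewrite hnormZR exprMn real_normK ?num_real// (hnormB_sqr b) (hnormD_sqr b).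
by field.
Qed.

(** A minimizing sequence is Cauchy by the parallelogram identity. *)
Lemma projection_exists G x : linear_subset G -> seq_complete G ->
  exists2 p, G p & forall g, G g -> ip (x - p) g = 0.
Proof.
move=> GL Gc; pose D := [set hnorm (x - g) ^+ 2 | g in G].
have D0 : D !=set0 by exists (hnorm (x - 0) ^+ 2), 0 => //; case: GL.
have Dlb : lbound D 0 by move=> _ [g _ <-]; exact: sqr_ge0.
have hD : has_inf D by split => //; exists 0.
have infle g : G g -> inf D <= hnorm (x - g) ^+ 2.
  by move=> Gg; apply: ge_inf; [exists 0|exists g].
have /choice[u Hu] n : exists g, G g /\ hnorm (x - g) ^+ 2 < inf D + n.+1%:R^-1.
  have [_ [g Gg <-] h] := @inf_adherent _ D n.+1%:R^-1 (ltac:(by [])) hD.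
  by exists g.
have cu : cauchy_seq u.
  move=> e e0.
  have e4 : 0 < e ^+ 2 / 4 by rewrite divr_gt0// exprn_gt0.
  have [n0 _ hn0] := near_infty_natSinv_lt (PosNum e4).
  exists n0 => m n mn0 nn0.
  rewrite -(@ltr_pXn2r _ 2)// ?nnegrE ?hnorm_ge0// ?ltW//.
  rewrite (parallelogram x).
  have [[Gm um] [Gn un]] := (Hu m, Hu n).
  have : inf D <= hnorm (x - (2^-1)%:C%C *: (u m + u n)) ^+ 2.
    apply: infle; apply: linear_subsetZ => //; exact: linear_subsetD.
  have := hn0 _ mn0; have := hn0 _ nn0.
  rewrite /= => a1 a2 a3; move: um un a1 a2 a3; clear.
  move: (inf D) (m.+1%:R^-1) (n.+1%:R^-1) => q b c.
  move: (hnorm (x - u m) ^+ 2) (hnorm (x - u n) ^+ 2) (e ^+ 2).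
  by move: (hnorm _ ^+ 2) => *; lra.
have [p Gp up] := Gc u (fun n => (Hu n).1) cu.
exists p => //; apply: closest_ip0 => // g Gg; apply: le_trans (infle g Gg).
have h1 : hnorm (x - u n) ^+ 2 @[n --> \oo] --> hnorm (x - p) ^+ 2.
  rewrite expr2; under eq_fun do rewrite expr2.
  by apply: cvgM; apply: cvg_hnorm; apply: cvgB => //; exact: cvg_cst.
have h2 : inf D + n.+1%:R^-1 @[n --> \oo] --> inf D + 0.
  by apply: cvgD; [exact: cvg_cst|exact: cvg_harmonic].
rewrite addr0 in h2.
apply: ler_cvg_to h1 h2 _.
by near=> n; apply: ltW; exact: (Hu n).2.
Unshelve. all: by end_near. Qed.

Lemma orth_proj_exists G : linear_subset G -> seq_complete G ->
  exists P : {linear H -> H}, (forall x, G (P x)) /\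
    (forall x g, G g -> ip (x - P x) g = 0).
Proof.
move=> GL Gc.
have /choice[P HP] : forall x, exists p, G p /\ forall g, G g -> ip (x - p) g = 0.
  by move=> x; have [p ? ?] := projection_exists x GL Gc; exists p.
have uniq x p q : G p -> G q -> (forall g, G g -> ip (x - p) g = 0) ->
    (forall g, G g -> ip (x - q) g = 0) -> p = q.
  move=> Gp Gq hp hq; apply/eqP; rewrite -subr_eq0; apply/eqP.
  have Gpq : G (p - q) by exact: linear_subsetB.
  apply: hnorm0_eq0; apply/eqP; rewrite -sqrf_eq0 -ripxx /rip.
  rewrite (_ : p - q = (x - q) - (x - p)) in Gpq *; last first.
    by rewrite opprB [RHS]addrC subrKA.
  by rewrite {1}ipBl hp// hq// subrr.
have lin : linear P.
  move=> a x y; apply: (uniq (a *: x + y)).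
  - exact: (HP _).1.
  - by apply: (GL.2); apply: (HP _).1.
  - exact: (HP _).2.
  - move=> g Gg; rewrite opprD addrACA -scalerBr ipDl ipZl.
    by rewrite !(HP _).2// mulr0 addr0.
pose M := GRing.isLinear.Build R[i] H H *:%R P lin.
pose L : {linear H -> H} := HB.pack P M.
by exists L; split => [x|x g]; [exact: (HP x).1|exact: (HP x).2].
Qed.

End Projection.

(** * Orthogonal sums *)

(** An alias is needed, because the product type itself carries the maximum
    norm, which does not come from an inner product. *)
Definition hsum (U V : Type) := (U * V)%type.

Section HSum.
Context (R : realType) (U V : preHilbertType R).

HB.instance Definition _ := GRing.Lmodule.on (hsum U V).

Let sip (p q : hsum U V) : R[i] := ip p.1 q.1 + ip p.2 q.2.

Let sip_linearl (a : R[i]) (x y z : hsum U V) :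
  sip (a *: x + y) z = a * sip x z + sip y z.
Proof. by rewrite /sip/= !ip_linearl mulrDr addrACA. Qed.

Let sip_conj (x y : hsum U V) : sip y x = (sip x y)^*.
Proof. by rewrite /sip rmorphD/= -!ip_conj. Qed.

Let ipxx_ge0 (W : preHilbertType R) (x : W) : 0 <= ip x x.
Proof. by rewrite ip_norm exprn_ge0. Qed.

Let sip_ge0 (x : hsum U V) : 0 <= sip x x.
Proof. by rewrite addr_ge0. Qed.

Let sip_eq0 (x : hsum U V) : sip x x = 0 -> x = 0.
Proof.
move=> /eqP; rewrite /sip paddr_eq0// !ip_norm !sqrf_eq0 !normr_eq0.
by case: x => a b /= /andP[/eqP -> /eqP ->].
Qed.

HB.instance Definition _ := Lmodule_isPreHilbert.Build R (hsum U V)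
  sip_linearl sip_conj sip_ge0 sip_eq0.

Lemma hsum_ipE (p q : hsum U V) : ip p q = ip p.1 q.1 + ip p.2 q.2.
Proof. by []. Qed.

Lemma hsum_ripE (p q : hsum U V) : rip p q = rip p.1 q.1 + rip p.2 q.2.
Proof. by rewrite /rip hsum_ipE Defs.ReD. Qed.

Lemma hsum_hnormE (p : hsum U V) : hnorm p ^+ 2 = hnorm p.1 ^+ 2 + hnorm p.2 ^+ 2.
Proof. by rewrite -!ripxx hsum_ripE. Qed.

Lemma hsum_le1 (p : hsum U V) : hnorm p.1 <= hnorm p.
Proof.
by rewrite -(@ler_pXn2r _ 2)// ?nnegrE ?hnorm_ge0// hsum_hnormE lerDl sqr_ge0.
Qed.

Lemma hsum_le2 (p : hsum U V) : hnorm p.2 <= hnorm p.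
Proof.
by rewrite -(@ler_pXn2r _ 2)// ?nnegrE ?hnorm_ge0// hsum_hnormE lerDr sqr_ge0.
Qed.

Lemma hsum_le (p : hsum U V) : hnorm p <= hnorm p.1 + hnorm p.2.
Proof.
rewrite -(@ler_pXn2r _ 2)// ?nnegrE ?addr_ge0 ?hnorm_ge0// hsum_hnormE.
by rewrite sqrrD lerD2r lerDl mulrn_wge0// mulr_ge0 ?hnorm_ge0.
Qed.

End HSum.

Section HPowTheory.
Context (R : realType) (N : nat) (H : preHilbertType R).
Implicit Types u v : hpow N H.

Lemma hpow_ripE u v : rip u v = \sum_(k < N) rip (u k) (v k).
Proof. by rewrite /rip hpow_ipE (raddf_sum (@complex.Re R)). Qed.

Lemma hpow_hnormE u : hnorm u ^+ 2 = \sum_(k < N) hnorm (u k) ^+ 2.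
Proof. by rewrite -ripxx hpow_ripE; apply: eq_bigr => k _; rewrite ripxx. Qed.

Lemma hpow_le u k : hnorm (u k) <= hnorm u.
Proof.
rewrite -(@ler_pXn2r _ 2)// ?nnegrE ?hnorm_ge0// hpow_hnormE (bigD1 k)//=.
by rewrite lerDl sumr_ge0// => j _; exact: sqr_ge0.
Qed.

Lemma hpow_le_sum u : hnorm u <= \sum_(k < N) hnorm (u k).
Proof.
have s0 : 0 <= \sum_(k < N) hnorm (u k).
  by apply: sumr_ge0 => k _; exact: hnorm_ge0.
rewrite -(@ler_pXn2r _ 2)// ?nnegrE ?hnorm_ge0// hpow_hnormE expr2 mulr_suml.
apply: ler_sum => k _; rewrite expr2 ler_wpM2l ?hnorm_ge0// (bigD1 k)//=.
by rewrite lerDl sumr_ge0// => j _; exact: hnorm_ge0.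
Qed.

End HPowTheory.

(** * Lax-Milgram *)

Section Complete.
Context (R : realType).

Lemma cauchy_seq_bounded (X : preHilbertType R) (u : nat -> X) :
  cauchy_seq u -> exists M : R, \forall n \near \oo, hnorm (u n) <= M.
Proof.
move=> /(_ 1 ltr01)[n0 h]; exists (hnorm (u n0) + 1); exists n0 => // n /= n0n.
rewrite -(subrK (u n0) (u n)) addrC; apply: le_trans (ler_hnormD _ _) _.
by rewrite lerD2l ltW// h.
Qed.

(** A Cauchy sequence converges as soon as it converges along one filter finer
    than [\oo], by which it has a cluster point. *)
Lemma cauchy_seq_ultra (X : preHilbertType R) (u : nat -> X)
  (F : set_system nat) {FF : ProperFilter F} (l : X) : \oo `<=` F ->
  cauchy_seq u -> u n @[n --> F] --> l -> u n @[n --> \oo] --> l.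
Proof.
move=> ooF uc /hcvgP h; apply/hcvgP => e e0.
have e2 := divr_gt0 e0 (ltr0n R 2); have [n0 hn] := uc _ e2.
have Fn0 : F [set n | (n0 <= n)%N] by apply: ooF; exists n0.
have [m [/= um mn]] := filter_ex (filterI (h _ e2) Fn0).
exists n0 => // n /= nn; apply: le_lt_trans (ler_hdistD (u m) _ _) _.
by rewrite (splitr e) ltrD// hn.
Qed.

Lemma hilbert_seq_cvg (V : hilbertType R) (u : nat -> V) : cauchy_seq u ->
  exists l : V, u n @[n --> \oo] --> l.
Proof.
move=> uc; suff : cvg (u n @[n --> \oo]) by exists (lim (u n @[n --> \oo])).
apply: cauchy_cvg; apply: cauchy_exP => e e0.
have er : e = (complex.Re e)%:C%C by rewrite RRe_real// gtr0_real.
have /uc [n0 hn] : 0 < complex.Re e by rewrite -ltcR -er.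
exists (u n0); exists n0 => // n /= nn; rewrite -ball_normE/=.
by rewrite er hnormE ltcR hn.
Qed.

End Complete.

Section LaxMilgram.
Context (R : realType) (X : preHilbertType R) (G : set X) (D : {linear X -> X}).
Hypotheses (GL : linear_subset G) (Gc : seq_complete G).
Hypotheses (Db : bounded_operator D).
Variable m : R.
Hypotheses (m0 : 0 < m) (Dm : forall x, m * hnorm x ^+ 2 <= rip (D x) x).

(** Let [P] be the projection onto [G].  By coercivity [P D] is bounded below on
    [G], so its range [K] is complete.  A vector [z] of [G] orthogonal to [K] is
    orthogonal to [P (D z)], hence zero, again by coercivity.  So [K] is all of
    [G] and contains [P F]. *)
Lemma lax_milgram F : exists2 g, G g & forall h, G h -> ip (D g - F) h = 0.
Proof.
have [P [GP Porth]] := orth_proj_exists GL Gc.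
have PG x h : G h -> ip (P x) h = ip x h.
  by move=> /(Porth x); rewrite ipBl => /eqP; rewrite subr_eq0 => /eqP.
have Pb : bounded_operator P.
  by exists 1 => x; rewrite mul1r hnorm_orth_le ?Porth.
pose K := [set P (D g) | g in G].
have KL : linear_subset K.
  split; first by exists 0; rewrite ?linear0//; exact: GL.1.
  move=> a _ _ [x Gx <-] [y Gy <-]; exists (a *: x + y); first exact: GL.2.
  by rewrite !linearP.
have below g : G g -> m * hnorm g <= hnorm (P (D g)).
  move=> Gg; have [->|g0] := eqVneq (hnorm g) 0; first by rewrite mulr0 hnorm_ge0.
  have p0 : 0 < hnorm g by rewrite lt0r g0 hnorm_ge0.
  rewrite -(ler_pM2r p0) -mulrA -expr2; apply: le_trans (Dm g) _.
  by rewrite /rip -PG//; exact: ler_rip.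
have Kc : seq_complete K.
  move=> u uK uc; have /choice[g Hg] n : exists g, G g /\ P (D g) = u n.
    by have [g ? ?] := uK n; exists g.
  have gc : cauchy_seq g.
    move=> e e0; have [n0 hn] := uc _ (mulr_gt0 m0 e0); exists n0 => i j ii jj.
    rewrite -(ltr_pM2l m0); apply: le_lt_trans (hn _ _ ii jj).
    rewrite -!(Hg _).2 -!linearB; apply: below.
    by apply: linear_subsetB => //; exact: (Hg _).1.
  have [l Gl gl] := Gc (fun n => (Hg n).1) gc.
  exists (P (D l)); first by exists l.
  have -> : u = (fun n => P (D (g n))) by apply/funext => n; rewrite (Hg n).2.
  by apply: bounded_cvg => //; apply: bounded_cvg.
have [q Kq hq] := projection_exists (P F) KL Kc.
have [g Gg gq] := Kq; exists g => // h Gh.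
suff z0 : P F - q = 0.
  rewrite ipBl -(PG (D g) h Gh) -(PG F h Gh) gq -ipBl.
  by rewrite -opprB z0 oppr0 ip0l.
set z := P F - q in hq *.
have Gz : G z by apply: linear_subsetB => //; rewrite -gq.
apply: hnorm0_eq0; apply/eqP; rewrite -sqrf_eq0 eq_le sqr_ge0 andbT.
rewrite -(pmulr_rle0 _ m0); apply: le_trans (Dm z) _.
rewrite /rip -(PG _ _ Gz); have := hq (P (D z)) (ex_intro2 _ _ z Gz erefl).
by move=> /ip_eq0C ->.
Qed.

End LaxMilgram.

(** * Closed operators with compactly embedded domain *)

Lemma ultra_fmap T U (F : set_system T) (f : T -> U) :
  UltraFilter F -> UltraFilter (f @ F).
Proof.
move=> FU; split=> [|G PG FG]; first exact: fmap_proper_filter.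
apply/seteqP; split => A; last exact: FG.
have [//|nA GA] := in_ultra_setVsetC (f @^-1` A) FU.
have : G (~` A) by exact: FG.
by move=> /(filterI GA); rewrite setICr => /filter_not_empty.
Qed.

Section Closed.
Context (R : realType) (U V : preHilbertType R) (A : operator U V).
Hypotheses (A_lin : linear_operator A) (A_closed : closed_operator A).

Lemma closed_operator_cvg T (F : set_system T) {FF : ProperFilter F}
    (u : T -> U) (l : U) (m : V) : (\forall t \near F, dom A (u t)) ->
  u t @[t --> F] --> l -> A (u t) @[t --> F] --> m -> dom A l /\ A l = m.
Proof.
move=> Fu ul Aum.
have h : (u t, A (u t)) @[t --> F] --> (l, m) by exact: cvg_pair.
by apply: (closed_cvg _ A_closed _ _ h); apply: filterS Fu => t.
Qed.

Lemma operatorB x y : dom A x -> dom A y ->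
  dom A (x - y) /\ A (x - y) = A x - A y.
Proof.
move=> dx dy; have := A_lin.2 (-1) y x dy dx.
by rewrite !scaleN1r (addrC (- y)) (addrC (- A y)).
Qed.

Lemma linear_operator0 : A 0 = 0.
Proof.
by have [_] := operatorB A_lin.1 A_lin.1; rewrite !subrr.
Qed.

Lemma operatorZ a x : dom A x -> dom A (a *: x) /\ A (a *: x) = a *: A x.
Proof.
by move=> dx; have := A_lin.2 a _ _ dx A_lin.1; rewrite linear_operator0 !addr0.
Qed.

Lemma graph_norm_le x a b : hnorm (A x) <= a -> hnorm x <= b ->
  graph_norm A x <= Num.sqrt (a ^+ 2 + b ^+ 2).
Proof.
move=> ha hb; rewrite /graph_norm ler_sqrt ?addr_ge0 ?sqr_ge0//.
have na := le_trans (hnorm_ge0 _) ha; have nb := le_trans (hnorm_ge0 _) hb.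
by rewrite lerD// lerXn2r// nnegrE hnorm_ge0.
Qed.

Hypothesis A_compact : compactly_embedded A.

(** Limits along ultrafilters instead of subsequences: a single ultrafilter
    makes all the components of a vector converge at once. *)
Lemma ultra_cvg T (F : set_system T) {FF : UltraFilter F} (u : T -> U) (a b : R) :
  (\forall t \near F, dom A (u t) /\ hnorm (A (u t)) <= a) ->
  (\forall t \near F, hnorm (u t) <= b) ->
  exists l : U, u t @[t --> F] --> l.
Proof.
move=> h1 h2; have := A_compact (Num.sqrt (a ^+ 2 + b ^+ 2)).
rewrite precompactE compact_ultra.
pose r := Num.sqrt (a ^+ 2 + b ^+ 2).
have hc : \forall t \near F,
    closure [set x | dom A x /\ graph_norm A x <= r] (u t).
  apply: filterS2 h1 h2 => t [du aut] ut.
  by apply: subset_closure; split => //; exact: graph_norm_le.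
move=> h; have [|l [_ ul]] := h (u t @[t --> F]) _ hc; last by exists l.
exact: ultra_fmap.
Qed.

End Closed.

Section Graph.
Context (R : realType) (U : preHilbertType R) (V : hilbertType R).
Context (A : operator U V).
Hypotheses (A_lin : linear_operator A) (A_closed : closed_operator A).
Hypothesis A_compact : compactly_embedded A.

Definition graph : set (hsum U V) := [set p | dom A p.1 /\ A p.1 = p.2].

Lemma graph_linear : linear_subset graph.
Proof.
split; first by split; [exact: A_lin.1|exact: linear_operator0].
move=> a x y [dx Ax] [dy Ay]; have [d E] := A_lin.2 a _ _ dx dy.
by split => //=; rewrite E Ax Ay.
Qed.

(** First components of a Cauchy sequence accumulate by the compact embedding,
    second components converge in the complete space [V], and the graph is
    closed. *)
Lemma graph_complete : seq_complete graph.
Proof.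
move=> p Gp pc.
have c1 : cauchy_seq (fun n => (p n).1).
  move=> e /pc[n0 h]; exists n0 => m n mn nn.
  by apply: le_lt_trans (h m n mn nn); exact: hsum_le1 (p m - p n).
have c2 : cauchy_seq (fun n => (p n).2).
  move=> e /pc[n0 h]; exists n0 => m n mn nn.
  by apply: le_lt_trans (h m n mn nn); exact: hsum_le2 (p m - p n).
have [m pm] := hilbert_seq_cvg c2.
have [b hb] := cauchy_seq_bounded c1; have [a ha] := cauchy_seq_bounded c2.
have [F [FU ooF]] := @ultraFilterLemma nat \oo _.
have [l pl] : exists l : U, (p n).1 @[n --> F] --> l.
  apply: (ultra_cvg A_compact (a := a) (b := b)); apply: ooF => //.
  by apply: filterS ha => n; have [d ->] := Gp n.
have {}pl : (p n).1 @[n --> \oo] --> l by exact: cauchy_seq_ultra ooF c1 pl.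
have [dl Al] : dom A l /\ A l = m.
  apply: (closed_operator_cvg A_closed _ pl).
    by apply: nearW => n; have [] := Gp n.
  have -> : (fun n => A (p n).1) = (fun n => (p n).2).
    by apply/funext => n; have [] := Gp n.
  exact: pm.
exists ((l, m) : hsum U V) => //.
apply/hcvgP => e e0; move/hcvgP : pl => /(_ _ (divr_gt0 e0 (ltr0n R 2))).
move/hcvgP : pm => /(_ _ (divr_gt0 e0 (ltr0n R 2))).
apply: filterS2 => n h1 h2; apply: le_lt_trans (hsum_le _) _.
by rewrite (splitr e) addrC ltrD.
Qed.

Hypothesis A_dense : densely_defined A.

Lemma adjoint_pair_uniq y z z' : adjoint_pair A y z -> adjoint_pair A y z' ->
  z = z'.
Proof.
move=> h h'; apply/eqP; rewrite -subr_eq0; apply/eqP.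
set w := z - z'; have hw x : dom A x -> ip x w = 0.
  by move=> dx; rewrite ipBr -h// -h'// subrr.
apply: contrapT => /eqP w0.
have nw : 0 < hnorm w.
  by rewrite lt0r hnorm_ge0 andbT; apply: contra_neq w0; exact: hnorm0_eq0.
have [x dx] := dense_near A_dense (near_hdist w nw).
rewrite hdistC ltNge => /negP; apply.
have r0 : rip w x = 0 by rewrite ripC /rip hw.
rewrite -(@ler_pXn2r _ 2)// ?nnegrE ?hnorm_ge0// (hnormB_sqr w x) r0.
by rewrite mulr0 subr0 lerDl sqr_ge0.
Qed.

Lemma adjointP y z : adjoint_pair A y z -> dom (adjoint A) y /\ adjoint A y = z.
Proof.
move=> h; split; first by exists z.
by apply: (@adjoint_pair_uniq y) => //; apply: (xgetPex 0); exists z.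
Qed.

Lemma adjoint_pairE y : dom (adjoint A) y -> adjoint_pair A y (adjoint A y).
Proof. by move=> h; exact: (xgetPex 0 h). Qed.

Variables (S : {linear V -> V}) (nu : R).
Hypotheses (S_bounded : bounded_operator S) (nu0 : 0 < nu).
Hypothesis S_coercive : forall h, nu * hnorm h ^+ 2 <= rip (S h) h.

(** The vector [u = lam (lam + A^* S A)^-1 v], that is the solution of
    [lam (u - v) + A^* S A u = 0], lies in the domain.  Testing this equation
    with [u - v] bounds [lam |u - v|^2] independently of [lam], so a large [lam]
    brings [u] close to [v]. *)
Lemma sandwich_approx v (e : R) : dom A v -> 0 < e ->
  exists2 u, dom (sandwich A S) u & hnorm (u - v) < e.
Proof.
move=> dv e0; have [M M0 SM] := bounded_le S_bounded.
(* the bound for lam |u - v|^2, from M a b <= nu a^2 + M^2 b^2 / (4 nu) *)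
pose K := M ^+ 2 * hnorm (A v) ^+ 2 / (4 * nu).
have K0 : 0 <= K.
  by apply: divr_ge0; apply: mulr_ge0; rewrite ?sqr_ge0 ?(ltW nu0).
pose lam := (K + 1) / e ^+ 2.
have e2 : 0 < e ^+ 2 by rewrite exprn_gt0.
have lam0 : 0 < lam by rewrite divr_gt0// ltr_wpDl.
pose D (p : hsum U V) : hsum U V := (lam%:C%C *: p.1, S p.2).
have Dlin : linear D.
  move=> a x y; have pe (p q : hsum U V) : p.1 = q.1 -> p.2 = q.2 -> p = q.
    by case: p q => [? ?] [? ?] /= -> ->.
  apply: pe => /=; last exact: linearP.
  by rewrite scalerDr !scalerA mulrC.
pose DM := GRing.isLinear.Build R[i] _ _ *:%R D Dlin.
pose L : {linear hsum U V -> hsum U V} := HB.pack D DM.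
have Lb : bounded_operator L.
  exists (lam + M) => p; apply: le_trans (hsum_le _) _.
  rewrite /= hnormZR gtr0_norm// mulrDl lerD//.
    by rewrite ler_wpM2l ?(ltW lam0)// hsum_le1.
  by apply: le_trans (SM _) _; rewrite ler_wpM2l ?(ltW M0)// hsum_le2.
pose m := Num.min lam nu.
have m0 : 0 < m by rewrite lt_min lam0.
have Lm p : m * hnorm p ^+ 2 <= rip (L p) p.
  rewrite hsum_ripE/= ripZl ripxx hsum_hnormE mulrDr lerD//.
    by rewrite ler_wpM2r ?sqr_ge0// ge_min lexx.
  apply: le_trans (S_coercive _); by rewrite ler_wpM2r ?sqr_ge0// ge_min lexx orbT.
have [[u y] [/= du Auy] hu] :=
  lax_milgram graph_linear graph_complete Lb m0 Lm ((lam%:C%C *: v, 0) : hsum U V).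
have {}hu z : dom A z ->
    ip (lam%:C%C *: (u - v)) z + ip (S (A u)) (A z) = 0.
  move=> dz; have := hu (z, A z) (conj dz erefl).
  by rewrite hsum_ipE/= subr0 scalerBr Auy.
exists u.
  split => //; exists (lam%:C%C *: (v - u)) => z dz.
  rewrite ip_conj [RHS]ip_conj; congr (_^*).
  by apply/eqP; rewrite -subr_eq0 -ipNl -scalerN opprB addrC hu.
have [duv Auv] := operatorB A_lin du dv.
have := congr1 (@complex.Re R) (hu _ duv).
rewrite Defs.ReD -/(rip _ _) -/(rip (S _) _) ripZl ripxx Auv ripBr /= => E.
have H1 := S_coercive (A u).
have H2 := ler_rip (S (A u)) (A v).
have H3 : rip (S (A u)) (A v) <= M * hnorm (A u) * hnorm (A v).
  by apply: le_trans H2 _; rewrite ler_wpM2r ?hnorm_ge0.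
have H4 : M * hnorm (A u) * hnorm (A v) <= nu * hnorm (A u) ^+ 2 + K.
  rewrite -subr_ge0.
  rewrite (_ : _ - _ = (2 * nu * hnorm (A u) - M * hnorm (A v)) ^+ 2 / (4 * nu)).
    by rewrite divr_ge0 ?sqr_ge0// mulr_ge0// ltW.
  by rewrite /K; field; rewrite gt_eqF.
have H5 : lam * hnorm (u - v) ^+ 2 < K + 1.
  move: E H1 H3 H4.
  by move: (lam * _) (rip _ (A u)) (rip _ (A v)) (nu * _) (M * _ * _) => *; lra.
rewrite -(@ltr_pXn2r _ 2)// ?nnegrE ?hnorm_ge0// ?ltW//.
by rewrite -(ltr_pM2l lam0) (_ : lam * e ^+ 2 = K + 1)// /lam mulfVK ?gt_eqF.
Qed.

Lemma sandwich_dense v (e : R) : 0 < e ->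
  exists2 u, dom (sandwich A S) u & hnorm (u - v) < e.
Proof.
move=> e0; have e2 := divr_gt0 e0 (ltr0n R 2).
have [x dx xv] := dense_near A_dense (near_hdist v e2).
have [u du ux] := sandwich_approx dx e2.
exists u => //; apply: le_lt_trans (ler_hdistD x _ _) _.
by rewrite (splitr e) ltrD.
Qed.

(** Moving [A^*] to the other side leaves the coercive form
    [- rip (S (A u)) (A u)]. *)
Lemma sandwich_dissipative u : dom (sandwich A S) u ->
  rip (sandwich A S u) u <= - nu * hnorm (A u) ^+ 2.
Proof.
move=> [du ds]; rewrite /= ripNl mulNr lerN2 ripC /rip -(adjoint_pairE ds)//.
by apply: le_trans (S_coercive _) _; rewrite -/(rip _ _) ripC.
Qed.

Lemma sandwich_ker u : dom A u -> A u = 0 ->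
  dom (sandwich A S) u /\ sandwich A S u = 0.
Proof.
move=> du Au; have [d E] : dom (adjoint A) (S (A u)) /\ adjoint A (S (A u)) = 0.
  by apply: adjointP => x _; rewrite Au linear0 !ip0r.
split; first by split.
by change (- adjoint A (S (A u)) = 0); rewrite E oppr0.
Qed.

End Graph.

(** * Functions with bounded right increments *)

Section Dini.
Context (R : realType).

(** The bound with slope [c + e] holds on an initial interval; left continuity
    closes this interval and the increment bound pushes it beyond its right end,
    unless that is [b]. *)
Lemma right_increment_le (f : R -> R) (b c : R) : 0 <= b ->
  (forall t, 0 < t -> t <= b -> f s @[s --> t^'-] --> f t) ->
  (forall t e, 0 <= t -> t < b -> 0 < e ->
     \forall h \near 0^'+, f (t + h) <= f t + (c + e) * h) ->
  f b <= f 0 + c * b.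
Proof.
move=> b0 lcont rinc.
suff main e : 0 < e -> f b <= f 0 + (c + e) * b.
  apply/ler_addgt0Pr => e e0.
  have b1 : 0 < b + 1 by rewrite ltr_wpDl.
  have := main _ (divr_gt0 e0 b1) => /le_trans; apply.
  rewrite mulrDl addrA lerD2l -mulrA ler_piMr ?(ltW e0)//.
  by rewrite [leLHS]mulrC ler_pdivrMr// mul1r lerDl.
move=> e0; pose g s := f 0 + (c + e) * s.
pose S := [set t | 0 <= t <= b /\ forall s, 0 <= s <= t -> f s <= g s].
have S0 : S 0.
  split; first by rewrite lexx.
  by move=> s; rewrite -eq_le => /eqP <-; rewrite /g mulr0 addr0.
have hS : has_sup S by split; [exists 0|exists b => t [/andP[]]].
pose m := sup S.
have m0 : 0 <= m by exact: (ub_le_sup hS.2 S0).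
have mb : m <= b by apply: ge_sup; [exists 0|move=> t [/andP[]]].
have below s : 0 <= s -> s < m -> f s <= g s.
  move=> s0 sm; have [t [tb ht] st] := sup_gt hS.1 sm.
  by apply: ht; rewrite s0 ltW.
have fm : f m <= g m.
  have [m0'|m0'] := eqVneq m 0; first by rewrite m0' /g mulr0 addr0.
  have mgt0 : 0 < m by rewrite lt0r m0'.
  have gl : g s @[s --> m^'-] --> g m.
    apply: cvgD; first exact: cvg_cst.
    by apply: cvgM; [exact: cvg_cst|exact: cvg_at_left_filter].
  apply: (ler_cvg_to (lcont _ mgt0 mb) gl).
  near=> s; apply: below; last by near: s; exact: nbhs_left_lt.
  by near: s; apply: nbhs_left_ge.
have Sm : S m.
  split; first by rewrite m0.
  move=> s /andP[s0]; rewrite le_eqVlt => /orP[/eqP->//|]; exact: below.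
have [bm|mb'] := eqVneq b m; first by move: fm; rewrite -bm.
exfalso; have {}mb' : m < b by rewrite lt_neqAle eq_sym mb' mb.
have [d /= d0 hd] := rinc m e m0 mb' e0.
pose h := Num.min (d / 2) (b - m).
have h0 : 0 < h by rewrite lt_min divr_gt0//= subr_gt0.
have : S (m + h).
  have hbm : h <= b - m by rewrite ge_min lexx orbT.
  split; first by rewrite addr_ge0 ?(ltW h0)//= -lerBrDl.
  move=> s /andP[s0 smh].
  have [sm|ms] := leP s m; first by apply: Sm.2; rewrite s0.
  have sm0 : 0 < s - m by rewrite subr_gt0.
  have : ball 0 d (s - m).
    rewrite /ball/= sub0r normrN gtr0_norm//.
    have : s - m <= h by rewrite lerBlDl.
    move=> /le_lt_trans; apply; rewrite gt_min ltr_pdivrMr//.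
    by rewrite ltr_pMr ?ltr1n.
  move=> /hd /(_ sm0); rewrite (addrC m) subrK => /le_trans; apply.
  by rewrite /g; move: fm; rewrite /g; lra.
by move=> /(ub_le_sup hS.2); rewrite -/m leNgt ltrDl h0.
Unshelve. all: by end_near. Qed.

End Dini.

(** * Strongly continuous semigroups *)

Section Semigroup.
Context (R : realType) (X : preHilbertType R).

Context (T : R -> {linear X -> X}) (T_C0 : C0_semigroup T).

Lemma semigroup0 x : T 0 x = x.
Proof. by case: T_C0. Qed.

Lemma semigroupD (s t : R) x : 0 <= s -> 0 <= t -> T (s + t) x = T s (T t x).
Proof. by case: T_C0 => _ _ + _; apply. Qed.

Lemma semigroup_bounded (t : R) : 0 <= t -> bounded_operator (T t).
Proof. by case: T_C0 => + _ _ _; apply. Qed.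

Lemma semigroup_cvg0 x : T t x @[t --> 0^'+] --> x.
Proof. by case: T_C0. Qed.

Let T0 := semigroup0.
Let TD := semigroupD.
Let Tb := semigroup_bounded.
Let Tc := semigroup_cvg0.

Lemma right_continuous_orbit (t : R) x : 0 <= t ->
  T (t + h) x @[h --> 0^'+] --> T t x.
Proof.
move=> t0; have h : T t (T h x) @[h --> 0^'+] --> T t x.
  exact: bounded_cvg (Tb t0) (@Tc x).
apply: (cvg_trans _ h); apply: near_eq_cvg; near=> r.
by rewrite TD.
Unshelve. all: by end_near. Qed.

(** By strong continuity from the right, [|T s| <= n] passes from a set of times
    to its limits from the right.  The sets of times at which [|T s| <= n] cover
    [`]0, t[], so by Baire's theorem one of them is dense in an interval, and
    the bound holds on a whole interval.  The semigroup law translates it to a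
    neighborhood of [t]. *)
Lemma locally_bounded (t : R) : 0 < t -> exists M : R,
  \forall s \near t, forall x, hnorm (T s x) <= M * hnorm x.
Proof.
move=> t0.
pose F (n : nat) : set R :=
  [set s | 0 < s < t /\ forall x, hnorm (T s x) <= n%:R * hnorm x].
have [n nd] : exists n, ~ dense (~` closure (F n)).
  apply: contrapT => /forallNP h.
  have : dense (\bigcap_n (~` closure (F n))).
    apply: (@Baire _ R^o) => n; split; last by apply: contrapT; exact: h.
    by apply: closed_openC; exact: closed_closure.
  have h2 : `]0, t[%classic (t / 2).
    by rewrite /= in_itv/= divr_gt0//= ltr_pdivrMr// ltr_pMr ?ltr1n.
  have oI : open (`]0, t[%classic : set R) by exact: interval_open.
  move=> /(_ `]0, t[%classic (ex_intro _ _ h2) oI).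
  case=> s [/=]; rewrite in_itv/= => st hs.
  have [s0 _] := andP st; have [M hM] := Tb (ltW s0).
  apply: (hs (Num.bound `|M|) I); apply: subset_closure; split => // x.
  apply: le_trans (hM x) _; rewrite ler_wpM2r ?hnorm_ge0//.
  by apply: le_trans (ler_norm M) _; apply/ltW/archi_boundP.
have [W [W0 Wo WF]] :
    exists W : set R, [/\ W !=set0, open W & W `<=` closure (F n)].
  apply: contrapT => /forallNP h; apply: nd => W W0 Wo.
  apply: contrapT => h2; apply: (h W); split=> // s Os.
  by apply: contrapT => ns; apply: h2; exists s.
have [s0 [Fs0 Os0]] : F n `&` W !=set0.
  have [p Op] := W0; have /WF := Op; apply; exact: open_nbhs_nbhs.
have [s0gt0 s0t] := andP Fs0.1.
(* density gives times r > s arbitrarily close to s at which the bound holds *)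
have nO : \forall s \near s0, forall x, hnorm (T s x) <= n%:R * hnorm x.
  have Onear : \forall s \near s0, W s by exact: open_nbhs_nbhs.
  near=> s; move=> x; have s_gt0 : 0 < s by near: s; exact: lt_nbhsr.
  rewrite leNgt; apply/negP => hx.
  have Onears : \forall r \near s, W r.
    by apply: open_nbhs_nbhs; split => //; near: s.
  have hr : \forall h \near 0^'+, n%:R * hnorm x < hnorm (T (s + h) x).
    exact: (cvgr_gt _ (cvg_hnorm (@right_continuous_orbit s x (ltW s_gt0)))).
  have sW : \forall h \near 0^'+, W (s + h).
    have : s + h @[h --> 0^'+] --> s + 0.
      by apply: cvgD; [exact: cvg_cst|exact: cvg_at_right_filter].
    by rewrite addr0; apply.
  have [d /= d0 hd] := filterI hr sW.
  have dd : 0 < d / 2 < d by rewrite divr_gt0//= ltr_pdivrMr// ltr_pMr ?ltr1n.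
  have inb h : 0 < h -> h < d -> ball 0 d h.
    by move=> h0 hlt; rewrite /ball/= sub0r normrN gtr0_norm.
  have [dd1 dd2] := andP dd.
  have /WF cl := (hd _ (inb _ dd1 dd2) dd1).2.
  have op : open_nbhs (s + d / 2) (`]s, s + d[%classic : set R).
    split; first exact: interval_open.
    by rewrite /= in_itv/= ltrDl dd1 ltrD2l dd2.
  have [r [[_ Fr]]] := cl _ (open_nbhs_nbhs op).
  rewrite /= in_itv/= => /andP[sr rd].
  have rs0 : 0 < r - s by rewrite subr_gt0.
  have rsd : r - s < d by rewrite ltrBlDl.
  have := (hd _ (inb _ rs0 rsd) rs0).1; rewrite /= addrC subrK ltNge.
  by rewrite Fr.
(* T s = T (s - t + s0) T (t - s0), where the first time is close to s0 *)
have ts0 : 0 <= t - s0 by rewrite subr_ge0 ltW.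
have [M hM] := Tb ts0; exists (n%:R * M).
have : s - t + s0 @[s --> t] --> t - t + s0.
  by apply: cvgD; [apply: cvgB|]; [exact: cvg_id|exact: cvg_cst|exact: cvg_cst].
rewrite subrr add0r => hs; have hn := hs _ nO.
have h0 := hs _ (lt_nbhsr s0gt0).
near=> s => x.
have -> : s = (s - t + s0) + (t - s0) by ring.
rewrite TD//; last by apply: ltW; near: s.
rewrite -mulrA; apply: (@le_trans _ _ (n%:R * hnorm (T (t - s0) x))).
  by move: x (T _ x) => _; near: s.
by rewrite ler_wpM2l.
Unshelve. all: by end_near. Qed.

(** Factoring out the smaller of the two times reduces continuity on both sides
    to right continuity at [0]. *)
Lemma hnorm_orbitB M (s t : R) x : 0 <= s -> 0 <= t ->
  (forall y, hnorm (T s y) <= M * hnorm y) ->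
  (forall y, hnorm (T t y) <= M * hnorm y) ->
  hnorm (T s x - T t x) <= M * hnorm (T `|s - t| x - x).
Proof.
move=> s0 t0 sM tM; have [st|/ltW st] := leP s t.
  have -> : T t x = T s (T (t - s) x) by rewrite -TD ?subr_ge0// addrC subrK.
  by rewrite ler0_norm ?subr_le0// opprB hdistC -linearB.
have -> : T s x = T t (T (s - t) x) by rewrite -TD ?subr_ge0// addrC subrK.
by rewrite ger0_norm ?subr_ge0// -linearB.
Qed.

Lemma continuous_orbit (t : R) x : 0 < t -> T s x @[s --> t] --> T t x.
Proof.
move=> t0; have [M hM] := locally_bounded t0.
pose M' := `|M| + 1.
have M0 : 0 < M' by rewrite ltr_wpDl.
have leM (y : X) : M * hnorm y <= M' * hnorm y.
  apply: ler_wpM2r; first exact: hnorm_ge0.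
  by apply: le_trans (ler_norm M) _; rewrite lerDl.
apply/hcvgP => e e0.
have /hcvgP /(_ _ (divr_gt0 e0 M0)) [d /= d0 hd] := @Tc x.
near=> s.
have [->|st] := eqVneq s t; first by rewrite subrr hnorm0.
have s0 : 0 < s by near: s; exact: lt_nbhsr.
apply: (@le_lt_trans _ _ (M' * hnorm (T `|s - t| x - x))).
  apply: hnorm_orbitB; [exact: ltW|exact: ltW| |] => y;
    apply: le_trans (leM y); move: y.
    by near: s.
  exact: nbhs_singleton hM.
rewrite mulrC -ltr_pdivlMr//; apply: hd; last by rewrite normr_gt0 subr_eq0.
rewrite /ball/= sub0r normrN normr_id distrC.
near: s; apply: (@nbhsx_ballx R R^o t d d0).
Unshelve. all: by end_near. Qed.

End Semigroup.

Section Generator.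
Context (R : realType) (X : preHilbertType R).
Context (T : R -> {linear X -> X}) (T_C0 : C0_semigroup T).

Let T0 := semigroup0 T_C0.
Let TD := semigroupD T_C0.
Let Tb := semigroup_bounded T_C0.
Let Tc := semigroup_cvg0 T_C0.

Local Notation G := (generator T).
Let q x (t : R) : X := (t^-1)%:C%C *: (T t x - x).

Lemma generator_cvg x : dom G x ->
  (t^-1)%:C%C *: (T t x - x) @[t --> 0^'+] --> G x.
Proof. by []. Qed.

Lemma generatorP x y : (t^-1)%:C%C *: (T t x - x) @[t --> 0^'+] --> y ->
  dom G x /\ G x = y.
Proof.
move=> h; split; first by apply/cvg_ex; exists y.
by apply: cvg_lim => //; exact: norm_hausdorff.
Qed.

Lemma generator_linear : linear_operator G.
Proof.
split.
  apply: (@generatorP 0 0 _).1.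
  under eq_fun do rewrite linear0 subrr scaler0.
  exact: cvg_cst.
move=> a x y /generator_cvg hx /generator_cvg hy; apply: generatorP.
rewrite (_ : (fun _ => _) = (fun t => a *: q x t + q y t)).
  by apply: cvgD => //; apply: cvgZr.
apply/funext => t; rewrite /q linearP opprD addrACA -scalerBr scalerDr.
by rewrite !scalerA mulrC.
Qed.

Lemma generator_orbit (t : R) x : 0 <= t -> dom G x ->
  dom G (T t x) /\ G (T t x) = T t (G x).
Proof.
move=> t0 /generator_cvg hx; apply: generatorP.
have h : T t (q x s) @[s --> 0^'+] --> T t (G x).
  exact: (bounded_cvg (Tb t0)).
apply: (cvg_trans _ h); apply: near_eq_cvg; near=> s.
have s0 : 0 <= s by apply: ltW; near: s; exact: nbhs_right_gt.
by rewrite /q linearZ/= linearB/= -!TD// (addrC t).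
Unshelve. all: by end_near. Qed.

(** The right derivative of [|T t y|^2] at [0] is [2 rip (G y) y]. *)
Lemma energy_increment y (e : R) : dom G y -> 0 < e ->
  \forall h \near 0^'+,
  `|hnorm (T h y) ^+ 2 - hnorm y ^+ 2 - 2 * rip (G y) y * h| <= e * h.
Proof.
move=> Gy e0; have qG := generator_cvg Gy.
have lim0 : 2 * rip (q y h) y + hnorm (T h y - y) * hnorm (q y h) @[h --> 0^'+]
    --> 2 * rip (G y) y + 0 * hnorm (G y).
  apply: cvgD; apply: cvgM.
  - exact: cvg_cst.
  - by apply: cvg_rip => //; exact: cvg_cst.
  - by apply/(hcvg0 (fun h => T h y)); exact: Tc.
  - exact: cvg_hnorm.
rewrite mul0r addr0 in lim0.
move/cvgrPdist_le : lim0 => /(_ _ e0) lim0.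
near=> h; have h0 : 0 < h by near: h; exact: nbhs_right_gt.
have h1 : `|h| = h by rewrite gtr0_norm.
have E1 : h * rip (q y h) y = rip (T h y - y) y.
  by rewrite ripZl mulrA divff ?mul1r// gt_eqF.
have E2 : h * hnorm (q y h) = hnorm (T h y - y).
  by rewrite hnormZR normfV h1 mulrA divff ?mul1r// gt_eqF.
(* with d = T h y - y the increment of the square is 2 rip d y + |d|^2 *)
have -> : hnorm (T h y) ^+ 2 - hnorm y ^+ 2 - 2 * rip (G y) y * h =
   - ((2 * rip (G y) y - (2 * rip (q y h) y + hnorm (T h y - y) * hnorm (q y h))) * h).
  rewrite -{1}(subrK y (T h y)) hnormD_sqr -E1 -E2; ring.
rewrite normrN normrM h1 ler_pM2r//.
by near: h.
Unshelve. all: by end_near. Qed.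

Lemma hnorm_orbit_sqr_left_cvg x (t : R) : 0 < t ->
  hnorm (T s x) ^+ 2 @[s --> t^'-] --> hnorm (T t x) ^+ 2.
Proof.
move=> t0; have h : hnorm (T s x) @[s --> t^'-] --> hnorm (T t x).
  apply: cvg_hnorm; apply: cvg_at_left_filter; exact: continuous_orbit.
by rewrite expr2; under eq_fun do rewrite expr2; exact: cvgM.
Qed.

(** The energy inequality, with the rate of change bounded at each time; this
    avoids integrating along orbits. *)
Lemma energy_le x (c tau : R) : dom G x -> 0 <= tau ->
  (forall t, 0 <= t -> t < tau -> 2 * rip (G (T t x)) (T t x) <= c) ->
  hnorm (T tau x) ^+ 2 <= hnorm x ^+ 2 + c * tau.
Proof.
move=> Gx tau0 hc; rewrite -{2}(T0 x).
apply: (@right_increment_le _ (fun t => hnorm (T t x) ^+ 2)) => //.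
  by move=> t t0 _; exact: hnorm_orbit_sqr_left_cvg.
move=> t e t0 tt e0; have [Gt _] := generator_orbit t0 Gx.
have := energy_increment Gt e0; apply: filter_app.
near=> h; have h0 : 0 < h by near: h; exact: nbhs_right_gt.
rewrite (addrC t h) TD// ?(ltW h0)// ler_distl => /andP[_].
have := hc t t0 tt; rewrite -(ler_pM2r h0); set A := 2 * _ * h.
by rewrite mulrDl; lra.
Unshelve. all: by end_near. Qed.

Lemma energy_ge x (c tau : R) : dom G x -> 0 <= tau ->
  (forall t, 0 <= t -> t < tau -> c <= 2 * rip (G (T t x)) (T t x)) ->
  hnorm x ^+ 2 + c * tau <= hnorm (T tau x) ^+ 2.
Proof.
move=> Gx tau0 hc; rewrite -{1}(T0 x).
rewrite -lerN2 opprD -(mulNr c).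
apply: (@right_increment_le _ (fun t => - hnorm (T t x) ^+ 2)) => //.
  by move=> t t0 _; apply: cvgN; exact: hnorm_orbit_sqr_left_cvg.
move=> t e t0 tt e0; have [Gt _] := generator_orbit t0 Gx.
have := energy_increment Gt e0; apply: filter_app.
near=> h; have h0 : 0 < h by near: h; exact: nbhs_right_gt.
rewrite (addrC t h) TD// ?(ltW h0)// ler_distl => /andP[+ _].
have := hc t t0 tt; rewrite -(ler_pM2r h0); set A := 2 * _ * h.
by rewrite mulrDl; lra.
Unshelve. all: by end_near. Qed.

End Generator.

(** * Dissipative semigroups *)

Section Dissipative.
Context (R : realType) (X : preHilbertType R).
Context (T : R -> {linear X -> X}) (T_C0 : C0_semigroup T).

Let T0 := semigroup0 T_C0.
Let TD := semigroupD T_C0.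
Let Tb := semigroup_bounded T_C0.
Let Tc := semigroup_cvg0 T_C0.

Local Notation G := (generator T).

Hypothesis G_dense : densely_defined G.
Variable q : X -> R.
Hypotheses (q_ge0 : forall x, 0 <= q x)
  (G_diss : forall x, dom G x -> rip (G x) x <= - q x).

Lemma dom_contraction (t : R) x : 0 <= t -> dom G x ->
  hnorm (T t x) <= hnorm x.
Proof.
move=> t0 dx; rewrite -(@ler_pXn2r _ 2)// ?nnegrE ?hnorm_ge0//.
have := @energy_le _ _ _ T_C0 x 0 t dx t0; rewrite mul0r addr0; apply.
move=> s s0 _; have [ds _] := generator_orbit T_C0 s0 dx.
rewrite pmulr_rle0//; apply: le_trans (G_diss ds) _.
by rewrite oppr_le0.
Qed.

Lemma contraction (t : R) x : 0 <= t -> hnorm (T t x) <= hnorm x.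
Proof.
move=> t0; rewrite leNgt; apply/negP => tx.
have h : hnorm y - hnorm (T t y) @[y --> x] --> hnorm x - hnorm (T t x).
  apply: cvgB; apply: cvg_hnorm; first exact: cvg_id.
  exact: bounded_cvg (Tb t0) _.
have hx : hnorm x - hnorm (T t x) < 0 by rewrite subr_lt0.
have [y dy] := dense_near G_dense (cvgr_lt _ h _ hx).
by rewrite subr_lt0 ltNge dom_contraction.
Qed.

(** Dissipation larger than [eta] throughout [`[0, tau[] would cost at least
    [2 eta tau] of the squared norm. *)
Lemma energy_time (tau eta : R) x : 0 < tau -> dom G x ->
  hnorm x ^+ 2 - hnorm (T tau x) ^+ 2 < 2 * eta * tau ->
  exists s, [/\ 0 <= s, s < tau, dom G (T s x) & q (T s x) <= eta].
Proof.
move=> tau0 dx hx; apply: contrapT => /forallNP h.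
have : hnorm (T tau x) ^+ 2 <= hnorm x ^+ 2 + (- (2 * eta)) * tau.
  apply: (energy_le T_C0 dx (ltW tau0)) => t t0 tt.
  have [dt _] := generator_orbit T_C0 t0 dx.
  rewrite -mulrN ler_pM2l//; apply: le_trans (G_diss dt) _.
  rewrite lerN2 leNgt; apply/negP => ht; apply: (h t); split => //.
  exact: ltW.
by move: hx; rewrite mulNr; lra.
Qed.

(** For each [z] the function [rip (T t x) z] has right derivative [0], hence is
    constant; this is used for [z = T t x - x]. *)
Lemma generator0_fixed x : dom G x -> G x = 0 ->
  forall t, 0 <= t -> T t x = x.
Proof.
move=> dx Gx t t0; set z := T t x - x.
have inc s : 0 <= s -> forall e, 0 < e ->
    \forall h \near 0^'+, `|rip (T (s + h) x) z - rip (T s x) z| <= e * h.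
  move=> s0 e e0; have [ds Gs] := generator_orbit T_C0 s0 dx.
  have : rip ((h^-1)%:C%C *: (T h (T s x) - T s x)) z @[h --> 0^'+] --> rip 0 z.
    apply: cvg_rip; last exact: cvg_cst.
    by have := generator_cvg ds; rewrite Gs Gx linear0.
  rewrite [rip 0 z]/rip ip0l => /cvgrPdist_le /(_ _ e0).
  apply: filter_app; near=> h.
  have h0 : 0 < h by near: h; exact: nbhs_right_gt.
  rewrite sub0r normrN ripZl (addrC s h) TD// ?(ltW h0)// ripBl.
  rewrite normrM gtr0_norm ?invr_gt0// mulrC.
  by rewrite ler_pdivrMr.
have lc s : 0 < s -> rip (T r x) z @[r --> s^'-] --> rip (T s x) z.
  move=> s0; apply: cvg_at_left_filter; apply: cvg_rip; last exact: cvg_cst.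
  exact: continuous_orbit.
have h1 : rip (T t x) z <= rip (T 0 x) z + 0 * t.
  apply: (@right_increment_le _ (fun s => rip (T s x) z)) => //.
    by move=> s s0 _; exact: lc.
  move=> s e s0 st e0; have := inc s s0 e e0; apply: filterS => h.
  by rewrite ler_distl add0r => /andP[].
have h2 : - rip (T t x) z <= - rip (T 0 x) z + 0 * t.
  apply: (@right_increment_le _ (fun s => - rip (T s x) z)) => //.
    by move=> s s0 _; apply: cvgN; exact: lc.
  move=> s e s0 st e0; have := inc s s0 e e0; apply: filterS => h.
  by rewrite ler_distl add0r => /andP[+ _]; lra.
have : rip z z = 0 by rewrite {1}/z ripBl; move: h1 h2; rewrite T0; lra.
rewrite ripxx => /eqP; rewrite sqrf_eq0 => /eqP /hnorm0_eq0 /eqP.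
by rewrite subr_eq0 => /eqP.
Unshelve. all: by end_near. Qed.

Definition fixed_vectors : set X := [set x | forall t, 0 <= t -> T t x = x].

Lemma fixed_dom x : fixed_vectors x -> dom G x /\ G x = 0.
Proof.
move=> fx; apply: generatorP.
have h : (0 : X) @[t --> 0^'+ : set_system R] --> (0 : X) by exact: cvg_cst.
apply: (cvg_trans _ h); apply: near_eq_cvg; near=> t.
have t0 : 0 <= t by apply: ltW; near: t; exact: nbhs_right_gt.
by rewrite fx// subrr scaler0.
Unshelve. all: by end_near. Qed.

Lemma fixed_linear : linear_subset fixed_vectors.
Proof.
split; first by move=> t _; rewrite linear0.
by move=> a x y fx fy t t0; rewrite linearP fx// fy.
Qed.

Lemma fixed_q0 x : fixed_vectors x -> q x = 0.
Proof.
move=> /fixed_dom[dx Gx]; have := G_diss dx.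
by rewrite Gx /rip ip0l oppr_ge0 => h; apply/eqP; rewrite eq_le h q_ge0.
Qed.

(** Contractivity on [a u + y], for a fixed vector [u] and real [a], leaves an
    inequality that is affine in [a]; so its slope is zero. *)
Lemma fixed_ip (t : R) x y : 0 <= t -> fixed_vectors x ->
  ip (T t y) x = ip y x.
Proof.
move=> t0 fx; apply/eqP; rewrite -subr_eq0 -ipBl; apply/eqP.
set z := T t y - y; suff r0 u : fixed_vectors u -> rip z u = 0.
  by apply: ip0P => a; apply: r0; exact: linear_subsetZ fixed_linear fx.
move=> fu; have key (a : R) :
    2 * a * rip z u <= hnorm y ^+ 2 - hnorm (T t y) ^+ 2.
  have := contraction (a%:C%C *: u + y) t0.
  rewrite -(@ler_pXn2r _ 2)// ?nnegrE ?hnorm_ge0// linearP fu//.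
  rewrite !hnormD_sqr !ripZl {1}/z ripBl (ripC _ u) (ripC _ u); lra.
apply: contrapT => /eqP r0; set K := hnorm y ^+ 2 - hnorm (T t y) ^+ 2 in key.
have := key ((K + 1) / (2 * rip z u)).
rewrite (_ : 2 * _ * _ = K + 1); last by field; rewrite r0.
by rewrite gerDl ler10.
Qed.

Lemma perp_orbit (t : R) y : 0 <= t ->
  (forall g, fixed_vectors g -> ip y g = 0) ->
  (forall g, fixed_vectors g -> ip (T t y) g = 0).
Proof. by move=> t0 hy g fg; rewrite fixed_ip// hy. Qed.

Definition conserved : set X :=
  [set x | forall t, 0 <= t -> hnorm (T t x) = hnorm x].

(** Contractivity gives two inequalities, for [a x + y] and for [a x - y]; by
    the parallelogram identity their sum is an equality. *)
Lemma conserved_linear : linear_subset conserved.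
Proof.
split; first by move=> t _; rewrite linear0.
have cZ a x : conserved x -> conserved (a *: x).
  by move=> cx t t0; rewrite linearZ/= !hnormZ cx.
move=> a x y cx cy t t0; have {}cx := cZ a _ cx t t0; have {}cy := cy t t0.
apply/eqP; rewrite eq_le contraction//= -(@ler_pXn2r _ 2)// ?nnegrE ?hnorm_ge0//.
have : hnorm (T t (a *: x - y)) ^+ 2 <= hnorm (a *: x - y) ^+ 2.
  by rewrite ler_pXn2r ?nnegrE ?hnorm_ge0// contraction.
rewrite raddfB raddfD/= !hnormB_sqr !hnormD_sqr cx cy; lra.
Qed.

Lemma conserved_orbit (t : R) x : 0 <= t -> conserved x -> conserved (T t x).
Proof. by move=> t0 cx s s0; rewrite -TD// !cx// addr_ge0. Qed.

Lemma conserved_closed (F : set_system R) {FF : ProperFilter F} (f : R -> X) (l : X) :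
  (\forall t \near F, conserved (f t)) -> f t @[t --> F] --> l -> conserved l.
Proof.
move=> cf fl t t0.
have h1 : hnorm (T t (f s)) @[s --> F] --> hnorm (T t l).
  by apply: cvg_hnorm; exact: bounded_cvg (Tb t0) fl.
have h2 : hnorm (f s) @[s --> F] --> hnorm l by exact: cvg_hnorm.
apply: (cvg_unique _ h1) => //.
apply: (cvg_trans _ h2); apply: near_eq_cvg.
by apply: filterS cf => s /(_ t t0).
Qed.

Lemma conserved_generator x : conserved x -> dom G x -> conserved (G x).
Proof.
move=> cx dx; apply: (conserved_closed _ (generator_cvg dx)).
near=> t; have t0 : 0 <= t by apply: ltW; near: t; exact: nbhs_right_gt.
have h : conserved (T t x - x).
  by apply: (linear_subsetB conserved_linear) => //; exact: conserved_orbit.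
exact: linear_subsetZ conserved_linear h.
Unshelve. all: by end_near. Qed.

(** The squared norm of the orbit is constant, and [2 rip (G x) x] is its
    derivative. *)
Lemma conserved_skew x : conserved x -> dom G x -> rip (G x) x = 0.
Proof.
move=> cx dx; apply/eqP; rewrite -normr_le0; apply/ler_addgt0Pr => e e0.
rewrite add0r; have [h [h0 hh]] : exists h : R, 0 < h /\
    `|hnorm (T h x) ^+ 2 - hnorm x ^+ 2 - 2 * rip (G x) x * h| <= 2 * e * h.
  have := energy_increment T_C0 dx (mulr_gt0 (ltr0n R 2) e0).
  move=> /(filterI (nbhs_right_gt 0)) /filter_ex[h [h0 hh]].
  by exists h.
move: hh; rewrite cx ?(ltW h0)// subrr sub0r normrN !normrM (gtr0_norm h0).
by rewrite ler_pM2r// ger0_norm// ler_pM2l.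
Qed.


Variables (n : nat) (e : {linear 'cV[R[i]]_n -> X}).
Hypothesis e_dom : forall c, dom G (e c).
(** This is what the compact embedding says about an abstract dissipation [q]:
    states with vanishing dissipation accumulate at the finite dimensional
    range of [e]. *)
Hypothesis compact_energy : forall (F : set_system nat), UltraFilter F ->
  \oo `<=` F -> forall (u : nat -> X) (b : R), (forall k, dom G (u k)) ->
  (forall k, hnorm (u k) <= b) -> q (u k) @[k --> \oo] --> (0 : R) ->
  exists c, u k @[k --> F] --> e c.

(** On fixed vectors the dissipation vanishes, so bounded sequences of them
    accumulate. *)
Lemma fixed_complete : seq_complete fixed_vectors.
Proof.
move=> u fu uc; have [b hb] := cauchy_seq_bounded uc.
have [F [FU ooF]] := @ultraFilterLemma nat \oo _.
have [n0 _ hn0] := hb.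
pose v k := u (k + n0)%N.
have vc : cauchy_seq v.
  move=> r /uc[m0 h]; exists m0 => i j ii jj.
  by apply: h; exact: leq_trans (leq_addr _ _).
have [c vl] : exists c, v k @[k --> F] --> e c.
  apply: (compact_energy FU ooF (b := b)).
  - by move=> k; have [] := fixed_dom (fu (k + n0)%N).
  - by move=> k; apply: hn0; exact: leq_addl.
  - rewrite (_ : (fun k => q (v k)) = cst 0); first exact: cvg_cst.
    by apply/funext => k; exact: fixed_q0 (fu _).
have {}vl : v k @[k --> \oo] --> e c by exact: cauchy_seq_ultra ooF vc vl.
have ul : u k @[k --> \oo] --> e c by move: vl; rewrite cvg_shiftn.
exists (e c) => // t t0.
have h : T t (u k) @[k --> \oo] --> T t (e c) by exact: bounded_cvg (Tb t0) ul.
have h2 : T t (u k) @[k --> \oo] --> e c.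
  by have -> : (fun k => T t (u k)) = u by apply/funext => k; rewrite fu.
exact: (cvg_unique (@norm_hausdorff _ X) h h2).
Qed.

(** Vectors [z k] of the domain close to [y] lose little norm up to time
    [k.+1^-1], so before that time their orbits meet points with small
    dissipation.  These points converge to [y] and accumulate at the range. *)
Lemma conserved_range y : conserved y -> exists c, y = e c.
Proof.
move=> cy.
have /choice[z Hz] : forall k : nat, exists z, exists s : R,
    [/\ dom G z, hnorm (z - y) < k.+1%:R^-1, 0 <= s, s < k.+1%:R^-1 &
    dom G (T s z) /\ q (T s z) <= k.+1%:R^-1].
  move=> k; set tau : R := k.+1%:R^-1; have tau0 : 0 < tau by rewrite invr_gt0.
  have h : hnorm z ^+ 2 - hnorm (T tau z) ^+ 2 @[z --> y] -->
      hnorm y ^+ 2 - hnorm (T tau y) ^+ 2.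
    have hT : T tau z @[z --> y] --> T tau y.
      exact: bounded_cvg (Tb (ltW tau0)) cvg_id.
    by apply: cvgB; rewrite expr2; under eq_fun do rewrite expr2;
      apply: cvgM; apply: cvg_hnorm => //; exact: cvg_id.
  have h0 : hnorm y ^+ 2 - hnorm (T tau y) ^+ 2 < 2 * tau * tau.
    by rewrite cy ?(ltW tau0)// subrr !mulr_gt0.
  have [z dz [z1 z2]] :=
    dense_near G_dense (filterI (near_hdist y tau0) (cvgr_lt _ h _ h0)).
  have [s [s0 st ds qs]] := energy_time tau0 dz z2.
  by exists z, s.
have /choice[s Hs] := Hz.
have [F [FU ooF]] := @ultraFilterLemma nat \oo _.
pose v k := T (s k) (z k).
have harm := @cvg_harmonic R.
have vy : v k @[k --> \oo] --> y.
  apply/hcvgP => r r0; have r2 := divr_gt0 r0 (ltr0n R 2).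
  have [d /= d0 hd] := (hcvgP _ _).1 (@Tc y) _ r2.
  near=> k; have [_ zy s0 sk _] := Hs k.
  apply: le_lt_trans (ler_hdistD (T (s k) y) _ _) _.
  rewrite (splitr r) ltrD//.
    rewrite /v -linearB; apply: le_lt_trans (contraction _ s0) _.
    apply: lt_trans zy _; near: k; exact: (near_infty_natSinv_lt (PosNum r2)).
  have [->|sk0] := eqVneq (s k) 0; first by rewrite T0 subrr hnorm0.
  apply: hd; last by rewrite lt0r sk0.
  rewrite /ball/= sub0r normrN ger0_norm//; apply: lt_trans sk _.
  near: k; exact: (near_infty_natSinv_lt (PosNum d0)).
have [c vc] : exists c, v k @[k --> F] --> e c.
  apply: (compact_energy FU ooF (b := hnorm y + 1)).
  - by move=> k; have [_ _ _ _ []] := Hs k.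
  - move=> k; have [_ zy s0 _ _] := Hs k.
    apply: le_trans (contraction _ s0) _.
    rewrite -(subrK y (z k)) addrC; apply: le_trans (ler_hnormD _ _) _.
    rewrite lerD2l; apply: le_trans (ltW zy) _.
    by rewrite invf_le1// ler1n.
  - apply: (squeeze_cvgr _ (cvg_cst 0) harm); near=> k.
    by have [_ _ _ _ [_ ->]] := Hs k; rewrite q_ge0.
exists c; apply: (cvg_unique (@norm_hausdorff _ X) _ vc).
exact: cvg_trans (cvg_app _ ooF) vy.
Unshelve. all: by end_near. Qed.


Lemma conserved_dom y : conserved y -> dom G y.
Proof. by move=> /conserved_range[c ->]. Qed.

Lemma conserved_step y : conserved y -> conserved (G y).
Proof. by move=> cy; apply: conserved_generator => //; exact: conserved_dom. Qed.

Lemma conserved_iter k y : conserved y -> conserved (iter k G y).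
Proof. by move=> cy; elim: k => //= k; exact: conserved_step. Qed.

Lemma generator_linE a x y : conserved x -> conserved y ->
  G (a *: x + y) = a *: G x + G y.
Proof.
move=> cx cy; have [_ /(_ a x y)] := generator_linear T.
by move=> /(_ (conserved_dom cx) (conserved_dom cy))[].
Qed.

Lemma generator0 : G 0 = 0.
Proof. exact: linear_operator0 (generator_linear T). Qed.

(** Skewness, polarized at [y] and [G y]. *)
Lemma conserved_ker2 y : conserved y -> G (G y) = 0 -> G y = 0.
Proof.
move=> cy GGy; have cz := conserved_step cy; set z := G y in GGy cz *.
have cyz : conserved (1 *: y + z) by exact: conserved_linear.2.
have := conserved_skew cyz (conserved_dom cyz).
rewrite generator_linE// GGy addr0 !scale1r -/z ripDr.
rewrite (conserved_skew cy (conserved_dom cy)) add0r ripxx.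
by move=> /eqP; rewrite sqrf_eq0 => /eqP /hnorm0_eq0.
Qed.

(** The value of [p(G)] at [y] when [m] is at least the size of [p]; the bound
    [m] is the parameter of the induction below. *)
Let act m (p : {poly R[i]}) y : X := \sum_(i < m) p`_i *: iter i G y.

Let iterGB a i y z : conserved y -> conserved z ->
  iter i G (a *: y + z) = a *: iter i G y + iter i G z.
Proof.
move=> cy cz; elim: i => [//|i IH]; rewrite !iterS IH.
by rewrite generator_linE//; exact: conserved_iter.
Qed.

Let act_factor m (p : {poly R[i]}) a y : conserved y -> (size p <= m)%N ->
  act m.+1 (p * ('X - a%:P)) y = act m p ((- a) *: y + G y).
Proof.
move=> cy pm; rewrite /act.
have := fun i => iterGB (- a) i cy (conserved_step cy).
move: (op_fun G) => g gB; under [RHS]eq_bigr do rewrite gB scalerDr.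
rewrite big_split/= [RHS]addrC mulrBr.
under eq_bigr do rewrite coefB scalerBl.
rewrite sumrB; congr (_ + _).
  rewrite big_ord_recl coefMX/= scale0r add0r; apply: eq_bigr => i _.
  by rewrite coefMX/= -iterS iterSr.
rewrite big_ord_recr/= coefMC (nth_default _ pm) mul0r scale0r addr0.
rewrite -sumrN; apply: eq_bigr => i _.
by rewrite coefMC scalerA mulrN scaleNr.
Qed.

Hypothesis no_eig : forall beta : R, beta != 0 ->
  ~ op_eigenvalue G (0 +i* beta)%C.

(** Eigenvalues of a skew operator are imaginary, so only [0] is left. *)
Let eigen_conserved a z : conserved z -> G z = a *: z -> G z = 0.
Proof.
move=> cz Gz; have [->|z0] := eqVneq z 0.
  exact: generator0.
have := conserved_skew cz (conserved_dom cz).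
rewrite Gz ripZ_self => /eqP.
rewrite mulf_eq0 sqrf_eq0 => /orP[/eqP Rea|]; last first.
  by move=> /eqP /hnorm0_eq0 /eqP; rewrite (negbTE z0).
have [Ima|Ima] := eqVneq (complex.Im a) 0.
  have -> : a = 0 by apply/eqP; rewrite eq_complex Rea Ima /= !eqxx.
  by rewrite scale0r.
exfalso; apply: (no_eig Ima); exists z; split => //; first exact: conserved_dom.
by rewrite Gz; congr (_ *: _); apply/eqP; rewrite eq_complex Rea /= !eqxx.
Qed.

(** Induction on the degree.  If [p = r ('X - a)] annihilates [y], then [r]
    annihilates [z = G y - a y]; hence [G z = 0], which makes [G y] an
    eigenvector for [a].  So [G (G y) = 0], and [G y = 0] by skewness. *)
Let act_kernel m : forall (p : {poly R[i]}) y, p != 0 -> (size p <= m)%N ->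
  conserved y -> act m p y = 0 -> G y = 0.
Proof.
elim: m => [p y p0|m IH p y p0 pm cy py].
  by rewrite leqn0 size_poly_eq0 (negbTE p0).
have [/eqP/size_poly1P[c c0 pc]|p1] := eqVneq (size p) 1.
  move: py; rewrite /act big_ord_recl big1 ?addr0; last first.
    by move=> i _; rewrite pc coefC scale0r.
  rewrite pc coefC eqxx => /eqP; rewrite scaler_eq0 (negbTE c0) => /eqP y0.
  have -> : y = 0 by exact: y0.
  exact: generator0.
have /closed_rootP[a /factor_theorem[r pr]] := p1.
have r0 : r != 0 by apply: contraNneq p0 => r0; rewrite pr r0 mul0r.
have rm : (size r <= m)%N.
  by move: pm; rewrite pr size_Mmonic ?monicXsubC// size_XsubC addn2.
have cz : conserved ((- a) *: y + G y).
  by apply: conserved_linear.2 => //; exact: conserved_step.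
have := IH r _ r0 rm cz; rewrite -act_factor// -pr => /(_ py).
rewrite generator_linE//; last exact: conserved_step.
rewrite scaleNr addrC => /eqP; rewrite subr_eq0 => /eqP GG.
apply: conserved_ker2 => //; apply: eigen_conserved GG.
exact: conserved_step.
Qed.

(** The [n.+1] vectors [iter i G y] have linearly dependent coordinates in the
    [n]-dimensional range of [e]; the dependence is a polynomial annihilating
    [y]. *)
Lemma conserved_kernel y : conserved y -> G y = 0.
Proof.
move=> cy; have /choice[c Hc] : forall i : nat, exists c, iter i G y = e c.
  by move=> i; apply: conserved_range; exact: conserved_iter.
pose M : 'M[R[i]]_(n.+1, n) := \matrix_(i, j) c i j 0.
have /rowV0Pn[v /sub_kermxP vM v0] : kermx M != 0.
  rewrite -mxrank_eq0 mxrank_ker -lt0n subn_gt0 ltnS; exact: rank_leq_col.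
pose p := \poly_(i < n.+1) v 0 (inord i).
have pE (i : 'I_n.+1) : p`_i = v 0 i by rewrite coef_poly ltn_ord inord_val.
apply: (@act_kernel n.+1 p) => //; last 2 first.
- exact: size_poly.
- rewrite /act; under eq_bigr do rewrite pE Hc -linearZ.
  rewrite -linear_sum (_ : \sum_(i < n.+1) _ = 0) ?linear0//.
  apply/colP => j; rewrite summxE mxE.
  have := congr1 (fun A : 'rV_n => A 0 j) vM; rewrite !mxE => vMj.
  by rewrite -[RHS]vMj; apply: eq_bigr => i _; rewrite !mxE.
apply: contra_neq v0 => p0; apply/rowP => i.
by rewrite -pE p0 coef0 mxE.
Qed.


Lemma conserved_fixed y : conserved y -> fixed_vectors y.
Proof.
move=> cy; apply: generator0_fixed; first exact: conserved_dom.
exact: conserved_kernel.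
Qed.

(** By density, a vector that violates the decay estimate can be chosen in the
    domain; its component orthogonal to the fixed vectors is then normalized. *)
Lemma slow_decay_vector (P : {linear X -> X}) :
  (forall x, fixed_vectors (P x)) ->
  (forall x g, fixed_vectors g -> ip (x - P x) g = 0) ->
  forall tau theta : R, 0 <= tau -> 0 <= theta ->
  ~ (forall x, hnorm (T tau (x - P x)) <= theta * hnorm x) ->
  exists z, [/\ dom G z, forall g, fixed_vectors g -> ip z g = 0,
    hnorm z <= 1 & theta <= hnorm (T tau z)].
Proof.
move=> fP Porth tau theta tau0 theta0 /existsNP[x0 /negP]; rewrite -ltNge => hx0.
have Pb : bounded_operator P.
  by exists 1 => x; rewrite mul1r hnorm_orth_le ?Porth.
have cf : theta * hnorm x - hnorm (T tau (x - P x)) @[x --> x0] -->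
    theta * hnorm x0 - hnorm (T tau (x0 - P x0)).
  have Pc : P x @[x --> x0] --> P x0 by exact: bounded_cvg Pb cvg_id.
  have Tc' : T tau (x - P x) @[x --> x0] --> T tau (x0 - P x0).
    by apply: (bounded_cvg (Tb tau0)); apply: cvgB => //; exact: cvg_id.
  apply: cvgB; last exact: cvg_hnorm.
  apply: cvgM; first exact: cvg_cst.
  by apply: cvg_hnorm; exact: cvg_id.
have hx0' : theta * hnorm x0 - hnorm (T tau (x0 - P x0)) < 0 by rewrite subr_lt0.
have [x dx] := dense_near G_dense (cvgr_lt _ cf _ hx0'); rewrite subr_lt0 => hx.
have x0' : 0 < hnorm x.
  rewrite lt0r hnorm_ge0 andbT; apply/eqP => /hnorm0_eq0 xE.
  by move: hx; rewrite xE (linear0 P) subr0 (linear0 (T tau)) hnorm0 mulr0 ltxx.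
exists (((hnorm x)^-1)%:C%C *: (x - P x)); split.
- have [dz _] := operatorB (generator_linear T) dx (fixed_dom (fP x)).1.
  exact: (operatorZ (generator_linear T) _ dz).1.
- by move=> g fg; rewrite ipZl Porth// mulr0.
- rewrite hnormZR gtr0_norm ?invr_gt0// mulrC ler_pdivrMr// mul1r.
  by rewrite hnorm_orthB_le ?Porth.
- rewrite linearZ/= hnormZR gtr0_norm ?invr_gt0// mulrC ler_pdivlMr//.
  exact: ltW.
Qed.

(** Otherwise there are vectors in the unit ball, orthogonal to the fixed ones,
    whose norm stays close to [1] for longer and longer times.  Points of small
    dissipation on their orbits accumulate at a vector [y] of conserved norm at
    least [1].  It is fixed, but also orthogonal to the fixed vectors. *)
Lemma uniform_decay (P : {linear X -> X}) :
  (forall x, fixed_vectors (P x)) ->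
  (forall x g, fixed_vectors g -> ip (x - P x) g = 0) ->
  exists tau theta : R, [/\ 0 < tau, 0 <= theta, theta < 1 &
    forall x, hnorm (T tau (x - P x)) <= theta * hnorm x].
Proof.
move=> fP Porth; apply: contrapT => nodecay.
pose theta (k : nat) : R := 1 - k.+1%:R^-1.
have kinv (k : nat) : 0 < (k.+1%:R^-1 : R) <= 1.
  by rewrite invr_gt0 ltr0n/= invf_le1// ler1n.
have theta0 k : 0 <= theta k by rewrite subr_ge0; case/andP: (kinv k).
have theta1 k : theta k < 1 by rewrite gtrBl; case/andP: (kinv k).
have /choice[z Hz] : forall k : nat, exists z, [/\ dom G z,
    forall g, fixed_vectors g -> ip z g = 0,
    hnorm z <= 1 & theta k <= hnorm (T k.+1%:R z)].
  move=> k; apply: (slow_decay_vector fP Porth) => //.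
  move=> h; apply: nodecay; exists k.+1%:R, (theta k); split => //.
have mono (r t : R) x : 0 <= r -> r <= t -> hnorm (T t x) <= hnorm (T r x).
  move=> r0 rt; rewrite -(subrK r t) TD ?subr_ge0//.
  by apply: contraction; rewrite subr_ge0.
have /choice[s Hs] : forall k : nat, exists s : R,
    [/\ 0 <= s, s < 1, dom G (T s (z k)) & q (T s (z k)) <= 2 * k.+1%:R^-1].
  move=> k; have [dz _ z1 zt] := Hz k.
  have [k0 k1] := andP (kinv k).
  apply: energy_time => //; rewrite mulr1.
  have : theta k ^+ 2 <= hnorm (T 1 (z k)) ^+ 2.
    rewrite ler_pXn2r ?nnegrE ?hnorm_ge0//; apply: le_trans zt _.
    by apply: mono => //; rewrite ler1n.
  have : hnorm (z k) ^+ 2 <= 1 by rewrite exprn_ile1 ?hnorm_ge0.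
  rewrite /theta; move: (k.+1%:R^-1) k0 k1 => r k0 k1; nra.
have [F [FU ooF]] := @ultraFilterLemma nat \oo _.
pose v k := T (s k) (z k).
have harm : (k.+1%:R^-1 : R) @[k --> \oo] --> (0 : R) by exact: cvg_harmonic.
have [c vc] : exists c, v k @[k --> F] --> e c.
  apply: (compact_energy FU ooF (b := 1)).
  - by move=> k; have [] := Hs k.
  - move=> k; have [s0 _ _ _] := Hs k; have [_ _ z1 _] := Hz k.
    exact: le_trans (contraction _ s0) z1.
  - have h2 : 2 * k.+1%:R^-1 @[k --> \oo] --> (0 : R).
      by rewrite -[0](mulr0 2); apply: cvgM; [exact: cvg_cst|].
    apply: (squeeze_cvgr _ (cvg_cst 0) h2); near=> k.
    by have [_ _ _ ->] := Hs k; rewrite q_ge0.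
set y := e c in vc.
have y1 : hnorm y <= 1.
  have h1 : hnorm (v k) @[k --> F] --> hnorm y by exact: cvg_hnorm.
  have h2 : (1 : R) @[k --> F] --> (1 : R) by exact: cvg_cst.
  apply: (ler_cvg_to h1 h2); apply: nearW => k.
  have [s0 _ _ _] := Hs k; have [_ _ z1 _] := Hz k.
  exact: le_trans (contraction _ s0) z1.
have Ty t : 0 <= t -> 1 <= hnorm (T t y).
  move=> t0; have h1 : theta k @[k --> F] --> (1 : R).
    have : theta k @[k --> \oo] --> (1 : R).
      by rewrite -[X in _ --> X]subr0; apply: cvgB => //; exact: cvg_cst.
    by apply: cvg_trans; apply: cvg_app.
  have h2 : hnorm (T t (v k)) @[k --> F] --> hnorm (T t y).
    by apply: cvg_hnorm; exact: bounded_cvg (Tb t0) vc.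
  apply: (ler_cvg_to h1 h2); apply: ooF.
  exists (Num.bound t) => // k /= tk.
  have [_ _ _ zt] := Hz k; have [s0 s1 _ _] := Hs k.
  apply: le_trans zt _; rewrite /v -TD//; apply: mono; first exact: addr_ge0.
  rewrite -natr1; apply: lerD; last exact: ltW.
  by apply: le_trans (ltW (archi_boundP t0)) _; rewrite ler_nat.
(* |T t y| <= |y| <= 1 <= |T t y| *)
have cy : conserved y.
  move=> t t0; apply/eqP; rewrite eq_le contraction//=.
  by rewrite (le_trans y1)// Ty.
have fy := conserved_fixed cy.
have h1 : rip (v k) y @[k --> F] --> rip y y.
  by apply: cvg_rip => //; exact: cvg_cst.
have h2 : rip (v k) y @[k --> F] --> (0 : R).
  rewrite (_ : (fun k => rip (v k) y) = cst 0); first exact: cvg_cst.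
  apply/funext => k; have [_ zp _ _] := Hz k; have [s0 _ _ _] := Hs k.
  by rewrite /rip /v fixed_ip// zp.
have : rip y y = 0 by exact: (cvg_unique (@Rhausdorff R) h1 h2).
rewrite ripxx => /eqP; rewrite sqrf_eq0 => /eqP y0.
by have := Ty 0 (lexx 0); rewrite T0 y0 ler10.
Unshelve. all: by end_near. Qed.

(** For the projection [P] onto the fixed vectors, [T t - P] is [T t (1 - P)],
    and at [t = k tau] this is the [k]-th power of the strict contraction of
    [uniform_decay]. *)
Lemma decay_converges : converges_in_op_norm T.
Proof.
have [P [fP Porth]] := orth_proj_exists fixed_linear fixed_complete.
have [tau [theta [tau0 theta0 theta1 decay]]] := uniform_decay fP Porth.
have P0 x : (forall g, fixed_vectors g -> ip x g = 0) -> P x = 0.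
  move=> hx; apply: hnorm0_eq0; apply/eqP; rewrite -sqrf_eq0 -ripxx /rip.
  have := Porth x (P x) (fP x); rewrite ipBl hx// sub0r => /eqP.
  by rewrite oppr_eq0 => /eqP ->.
have pow k x : hnorm (T (k%:R * tau) (x - P x)) <= theta ^+ k * hnorm x.
  elim: k => [|k IH].
    by rewrite mul0r T0 expr0 mul1r hnorm_orthB_le ?Porth.
  have k0 : 0 <= k%:R * tau by rewrite mulr_ge0// ltW.
  rewrite -natr1 mulrDl mul1r addrC TD ?(ltW tau0)//.
  set z := T (k%:R * tau) (x - P x).
  have Pz : P z = 0 by apply: P0; apply: perp_orbit => //; exact: Porth.
  have := decay z; rewrite Pz subr0 => /le_trans; apply.
  by rewrite exprS -mulrA ler_wpM2l.
exists P.
  by exists 1 => x; rewrite mul1r hnorm_orth_le ?Porth.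
have op_ge0 (t : R) : (0 <= op_norm (fun x => (T t x - P x)%R))%E.
  apply: ereal_sup_ubound; exists 0; first by rewrite /= hnorm0.
  by rewrite (linear0 P) subr0 (linear0 (T t)) hnorm0.
have op_le k (t : R) : k%:R * tau <= t ->
    (op_norm (fun x => (T t x - P x)%R) <= (theta ^+ k)%:E)%E.
  move=> kt; apply: ge_ereal_sup => _ [x /= x1 <-]; rewrite lee_fin.
  have k0 : 0 <= k%:R * tau by rewrite mulr_ge0// ltW.
  have t0 := le_trans k0 kt.
  rewrite -(fP x t t0) -linearB -(subrK (k%:R * tau) t) TD ?subr_ge0//.
  apply: le_trans (contraction _ _) _; first by rewrite subr_ge0.
  by apply: le_trans (pow k x) _; rewrite ler_piMr// exprn_ge0.
have fin t : 0 <= t -> op_norm (fun x => T t x - P x) \is a fin_num.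
  move=> t0; rewrite ge0_fin_numE ?op_ge0//.
  by apply: le_lt_trans (op_le 0%N t _) _; rewrite ?mul0r// ltry.
apply/fine_cvgP; split.
  by near=> t; apply: fin; near: t; apply: nbhs_pinfty_ge; exact: num_real.
apply/cvgrPdist_le => r r0.
have : theta ^+ k @[k --> \oo] --> (0 : R) by apply: cvg_expr; rewrite ger0_norm.
move=> /cvgrPdist_le /(_ _ r0) [k _ /(_ k (leqnn k))/=].
rewrite sub0r normrN ger0_norm ?exprn_ge0// => hk.
near=> t.
have kt : k%:R * tau <= t.
  by near: t; apply: nbhs_pinfty_ge; exact: num_real.
have t0 : 0 <= t by apply: le_trans kt; rewrite mulr_ge0// ltW.
rewrite sub0r normrN ger0_norm ?fine_ge0 ?op_ge0//.
by rewrite -lee_fin fineK ?fin//; apply: le_trans (op_le k t kt) _; rewrite lee_fin.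
Unshelve. all: by end_near. Qed.

End Dissipative.

Section Converse.
Context (R : realType) (X : preHilbertType R).
Context (T : R -> {linear X -> X}) (T_C0 : C0_semigroup T).

Let TD := semigroupD T_C0.

Local Notation G := (generator T).

Lemma op_norm_cvg_pointwise (P : {linear X -> X}) (x : X) : hnorm x <= 1 ->
  op_norm (fun x => T t x - P x) @[t --> +oo%R] --> 0%E ->
  T t x @[t --> +oo%R] --> P x.
Proof.
move=> x1 /fine_cvgP[fin /cvgrPdist_lt h]; apply/hcvgP => e /h.
apply: filterS2 fin => t fint; rewrite sub0r normrN => ht.
apply: le_lt_trans ht; apply: le_trans (ler_norm _).
by rewrite -lee_fin fineK//; apply: ereal_sup_ubound; exists x.
Qed.

Lemma imaginary_eigenvector_hnorm (beta : R) x : dom G x ->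
  G x = (0 +i* beta)%C *: x -> forall t, 0 <= t -> hnorm (T t x) = hnorm x.
Proof.
move=> dx Gx t t0.
have r0 s : 0 <= s -> 2 * rip (G (T s x)) (T s x) = 0.
  move=> s0; have [_ ->] := generator_orbit T_C0 s0 dx.
  by rewrite Gx linearZ/= ripZ_self/= mul0r mulr0.
have le1 : hnorm (T t x) ^+ 2 <= hnorm x ^+ 2.
  have := @energy_le _ _ _ T_C0 x 0 t dx t0; rewrite mul0r addr0; apply.
  by move=> s s0 _; rewrite r0.
have le2 : hnorm x ^+ 2 <= hnorm (T t x) ^+ 2.
  have := @energy_ge _ _ _ T_C0 x 0 t dx t0; rewrite mul0r addr0; apply.
  by move=> s s0 _; rewrite r0.
apply/eqP; rewrite -(@eqrXn2 _ 2) ?hnorm_ge0//.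
by rewrite eq_le le1 le2.
Qed.

(** The limit [P] satisfies [P (T t x) = P x], so [P] kills the range of the
    generator, in particular an eigenvector [x]; thus [T t x] tends to [0],
    whereas its norm is constant. *)
Lemma convergent_no_imaginary_eigenvalue (beta : R) :
  converges_in_op_norm T -> beta != 0 -> ~ op_eigenvalue G (0 +i* beta)%C.
Proof.
move=> [P Pb TP] b0 [x0 [dx0 x00 Gx0]].
have n0 : 0 < hnorm x0.
  by rewrite lt0r hnorm_ge0 andbT; apply: contra_neq x00; exact: hnorm0_eq0.
pose x := ((hnorm x0)^-1)%:C%C *: x0.
have [dx Gx'] := operatorZ (generator_linear T) ((hnorm x0)^-1)%:C%C dx0.
have Gx : G x = (0 +i* beta)%C *: x by rewrite Gx' Gx0 /x !scalerA mulrC.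
have x1 : hnorm x = 1.
  by rewrite /x hnormZR gtr0_norm ?invr_gt0// mulVf// gt_eqF.
have nT := imaginary_eigenvector_hnorm dx Gx.
have Tx : T t x @[t --> +oo%R] --> P x by apply: op_norm_cvg_pointwise; rewrite ?x1.
have PT s : 0 <= s -> P (T s x) = P x.
  move=> s0; have h1 : T t (T s x) @[t --> +oo%R] --> P (T s x).
    by apply: op_norm_cvg_pointwise; rewrite ?nT ?x1.
  have h2 : T (t + s) x @[t --> +oo%R] --> P x.
    by apply: (cvg_comp (fun t => t + s) (fun t => T t x)) Tx; exact: cvg_addrr.
  apply: (cvg_unique (@norm_hausdorff _ X) h1); apply: (cvg_trans _ h2).
  apply: near_eq_cvg; near=> t.
  have t0 : 0 <= t by near: t; apply: nbhs_pinfty_ge; exact: num_real.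
  by rewrite TD.
have PG : P (G x) = 0.
  have h1 : P ((t^-1)%:C%C *: (T t x - x)) @[t --> 0^'+] --> P (G x).
    exact: bounded_cvg Pb (generator_cvg dx).
  have h2 : (0 : X) @[t --> 0^'+ : set_system R] --> (0 : X) by exact: cvg_cst.
  apply: (cvg_unique (@norm_hausdorff _ X) h1); apply: (cvg_trans _ h2).
  apply: near_eq_cvg; near=> t.
  have t0 : 0 <= t by apply: ltW; near: t; exact: nbhs_right_gt.
  by rewrite linearZ/= linearB/= PT// subrr scaler0.
have Px : P x = 0.
  move: PG; rewrite Gx linearZ/= => /eqP; rewrite scaler_eq0 => /orP[|/eqP//].
  by rewrite eq_complex/= eqxx/= (negbTE b0).
have h1 : hnorm (T t x) @[t --> +oo%R] --> (0 : R).
  by rewrite -(@hnorm0 _ X) -Px; exact: cvg_hnorm.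
have h2 : hnorm (T t x) @[t --> +oo%R] --> (1 : R).
  have h3 : (1 : R) @[t --> +oo%R : set_system R] --> (1 : R) by exact: cvg_cst.
  apply: (cvg_trans _ h3); apply: near_eq_cvg; near=> t.
  rewrite nT ?x1//; near: t; apply: nbhs_pinfty_ge; exact: num_real.
have : (0 : R) = 1 by exact: (cvg_unique (@Rhausdorff R) h1 h2).
by move/eqP; rewrite eq_sym oner_eq0.
Unshelve. all: by end_near. Qed.

End Converse.

(** * Matrix potentials *)

(** The integrand is almost everywhere equal to its absolute value. *)
Lemma Rintegral_ae_ge0 (R : realType) (d : measure_display)
  (T : measurableType d) (mu : {measure set T -> \bar R}) (f : T -> R) :
  mu.-integrable setT (EFin \o f) -> {ae mu, forall x, 0 <= f x} ->
  0 <= \int[mu]_x f x.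
Proof.
move=> fi f0; have mf := measurable_int _ fi.
rewrite (_ : \int[mu]_x f x = \int[mu]_x `|f x|); first exact: Rintegral_ge0.
congr fine; apply: ae_eq_integral => //.
  by apply/measurable_EFinP; apply: measurableT_comp => //; exact/measurable_EFinP.
by apply: filterS f0 => x fx _; rewrite /= ger0_norm.
Qed.

Section Potential.
Context (R : realType) (d : measure_display) (Omega : measurableType d).
Context (mu : {measure set Omega -> \bar R}) (N : nat).
Context (V : Omega -> 'M[R[i]]_N).
Hypotheses (V_meas : measurable_mx V) (V_bound : ess_bounded_mx mu V).

(** The left-hand side is the integral of the pointwise forms of [V x]. *)
Lemma mulop_dissipative (u : hpow N (L2 mu)) :
  {ae mu, forall x, dissipative_mx (V x)} -> rip (mulop V u) u <= 0.
Proof.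
move=> V_diss.
pose f k x := complex.Re (repr (mulop V u k) x * (repr (u k) x)^*).
have fi k : mu.-integrable setT (EFin \o f k).
  by have [] := sqintM (L2funP (repr (mulop V u k))) (L2funP (repr (u k))).
pose g x := \sum_(k < N) f k x.
have gi : mu.-integrable setT (EFin \o g).
  have := @integrable_sum _ _ _ mu setT measurableT _ (index_enum 'I_N) xpredT _
    (fun k _ => fi k).
  by congr (_.-integrable _ _); apply/funext => x; rewrite sumEFin.
have -> : rip (mulop V u) u = \int[mu]_x g x.
  rewrite hpow_ripE /Rintegral.
  under eq_integral do rewrite -sumEFin.
  rewrite (integral_sum measurableT fi) -sum_fine; last first.
    by move=> k _; exact: integrable_fin_num (fi k).
  by apply: eq_bigr => k _; rewrite /rip L2_ipE.
have ae_le : {ae mu, forall x, \sum_(k < N) f k x <= 0}.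
  have ae_mul : {ae mu, forall x, forall k : 'I_N,
      repr (mulop V u k) x = \sum_(j < N) V x k j * repr (u j) x}.
    by apply: filter_forall => k; exact: mulopE.
  apply: filterS2 V_diss ae_mul => x Vx mx.
  have := Vx (\col_k repr (u k) x); apply: le_trans.
  rewrite le_eqVlt; apply/orP; left; apply/eqP.
  rewrite (raddf_sum (@complex.Re R)); apply: eq_bigr => k _.
  rewrite /f mx !mxE; congr (complex.Re (_ * _)).
  by apply: eq_bigr => j _; rewrite mxE.
rewrite -oppr_ge0 -mulN1r -RintegralZl//; apply: Rintegral_ae_ge0.
  have := integrableZl measurableT (-1) gi; by congr (_.-integrable _ _).
by apply: filterS ae_le => x; rewrite mulN1r oppr_ge0.
Qed.

Lemma ae_cst_eq0 (P : Prop) : (exists u : L2 mu, u != 0) ->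
  {ae mu, forall x, P} -> P.
Proof.
move=> [u u0] aeP; apply: contrapT => nP; move/eqP : u0; apply.
by apply/L2_eqP; apply: filterS aeP => x /nP.
Qed.

Lemma ae_full_measure (P : Omega -> Prop) : {ae mu, forall x, P x} ->
  exists W, [/\ measurable W, mu (~` W) = 0%E & W `<=` P].
Proof.
move=> [B [mB B0 PB]]; exists (~` B); rewrite setCK; split => //.
  exact: measurableC.
by move=> x Bx; apply: contrapT => nP; apply: Bx; exact: PB.
Qed.

Lemma full_measure_ae (W : set Omega) (P : Omega -> Prop) : measurable W ->
  mu (~` W) = 0%E -> (forall x, W x -> P x) -> {ae mu, forall x, P x}.
Proof.
move=> mW W0 WP; exists (~` W); split => //; first exact: measurableC.
by move=> x /= nP; apply: contra_not nP; exact: WP.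
Qed.

Variable w : L2 mu.
Hypothesis w_neq0 : {ae mu, forall x, repr w x != 0}.

Definition wvec (c : 'cV[R[i]]_N) : hpow N (L2 mu) := [ffun k => c k 0 *: w].

Lemma mulop_wvec c : {ae mu, forall x, forall k : 'I_N,
  repr (mulop V (wvec c) k) x = (V x *m c) k 0 * repr w x}.
Proof.
apply: filter_forall => k.
have h : {ae mu, forall x, forall j : 'I_N,
    repr (wvec c j) x = c j 0 * repr w x}.
  by apply: filter_forall => j; rewrite ffunE; exact: L2_scaleE.
apply: filterS2 (mulopE (wvec c) k V_meas V_bound) h => x -> hx.
rewrite mxE mulr_suml; apply: eq_bigr => j _.
by rewrite hx mulrA.
Qed.

(** The scalar factor [repr w x] can be cancelled at almost every [x]. *)
Lemma mulop_wvec_eigen c l : mulop V (wvec c) = l *: wvec c <->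
  {ae mu, forall x, V x *m c = l *: c}.
Proof.
have h : {ae mu, forall x, forall k : 'I_N,
    repr ((l *: wvec c) k) x = l * c k 0 * repr w x}.
  apply: filter_forall => k; rewrite !ffunE scalerA; exact: L2_scaleE.
split=> E.
  apply: filterS3 w_neq0 (mulop_wvec c) h => x wx; rewrite E => h1 h2.
  apply/colP => k; apply: (mulIf wx); rewrite -h1 h2.
  by rewrite mxE.
apply/ffunP => k; apply/L2_eqP.
apply: filterS3 E (mulop_wvec c) h => x Ex -> ->.
by rewrite Ex mxE.
Qed.

Lemma wvec_eq0 c : (exists u : L2 mu, u != 0) -> wvec c = 0 -> c = 0.
Proof.
move=> L2n0 c0; apply/colP => k; rewrite mxE; apply: contrapT => ck.
have w0 : w = 0.
  move/ffunP : c0 => /(_ k); rewrite !ffunE => /eqP; rewrite scaler_eq0.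
  by case/orP => /eqP.
apply: (ae_cst_eq0 L2n0).
have h : {ae mu, forall x, repr (0 : L2 mu) x = 0}.
  have := L2_scaleE 0 w; rewrite scale0r; apply: filterS => x ->.
  by rewrite mul0r.
by apply: filterS2 w_neq0 h => x; rewrite w0 => /eqP.
Qed.

End Potential.

(** * The coupled operator *)

Section Coupled.
Context (R : realType) (d : measure_display)
  (Omega : measurableType d) (mu : {measure set Omega -> \bar R})
  (H2 : hilbertType R) (A21 : operator (L2 mu) H2)
  (N : nat) (S : 'I_N -> {linear H2 -> H2}) (nu : R)
  (V : Omega -> 'M[R[i]]_N) (w : L2 mu).
Hypotheses (L2_nonzero : exists u : L2 mu, u != 0)
  (A21_linear : linear_operator A21)
  (A21_closed : closed_operator A21)
  (A21_dense : densely_defined A21)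
  (S_bounded : forall k, bounded_operator (S k))
  (nu_gt0 : 0 < nu)
  (S_coercive : forall k (h : H2), nu * hnorm h ^+ 2 <= rip (S k h) h)
  (V_measurable : measurable_mx V)
  (V_bounded : ess_bounded_mx mu V)
  (w_neq0 : {ae mu, forall x, repr w x != 0})
  (ker_A21 : operator_kernel A21 = [set c *: w | c in [set: R[i]]])
  (V_dissipative : {ae mu, forall x, dissipative_mx (V x)}).

Local Notation C := (coupled_operator A21 S V).
Local Notation X := (hpow N (L2 mu)).

Lemma coupled_dissipative (u : X) : dom C u ->
  rip (C u) u <= - nu * \sum_(k < N) hnorm (A21 (u k)) ^+ 2.
Proof.
move=> du; rewrite [C u]/(_ + _) ripDl -[leRHS]addr0 lerD//; last first.
  exact: mulop_dissipative.
rewrite hpow_ripE mulr_sumr; apply: ler_sum => k _; rewrite ffunE.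
exact: sandwich_dissipative (S_coercive k) _ (du k).
Qed.

Lemma kernelP v : dom A21 v -> A21 v = 0 -> exists c, v = c *: w.
Proof.
move=> dv v0; have : operator_kernel A21 v by split.
by rewrite ker_A21 => -[c _ <-]; exists c.
Qed.

Lemma kernel_wvec (u : X) : (forall k, dom A21 (u k)) ->
  (forall k, A21 (u k) = 0) -> exists c, u = wvec w c.
Proof.
move=> du u0; have /choice[c Hc] k : exists c, u k = c *: w by exact: kernelP.
by exists (\col_k c k); apply/ffunP => k; rewrite ffunE mxE.
Qed.

Lemma coupled_kernel (u : X) : (forall k, dom A21 (u k)) ->
  (forall k, A21 (u k) = 0) -> dom C u /\ C u = mulop V u.
Proof.
move=> du u0.
have h k := sandwich_ker A21_dense (S k) (du k) (u0 k).
split; first by move=> k; exact: (h k).1.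
have D0 : diag_operator (fun k => sandwich A21 (S k)) u = 0.
  by apply/ffunP => k; rewrite !ffunE; exact: (h k).2.
by rewrite [C u]/(_ + _) D0; exact: add0r.
Qed.

Lemma wvec_kernel (c : 'cV[R[i]]_N) : (forall k, dom A21 (wvec w c k)) /\
  (forall k, A21 (wvec w c k) = 0).
Proof.
have h k : operator_kernel A21 (wvec w c k).
  by rewrite ker_A21 ffunE; exists (c k 0).
by split => k; have [] := h k.
Qed.

Lemma coupled_wvec (c : 'cV[R[i]]_N) :
  dom C (wvec w c) /\ C (wvec w c) = mulop V (wvec w c).
Proof. have [h1 h2] := wvec_kernel c; exact: coupled_kernel. Qed.

(** An eigenvector for an imaginary eigenvalue dissipates no energy. *)
Lemma imaginary_eigenvector (beta : R) (u : X) : dom C u ->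
  C u = (0 +i* beta)%C *: u -> forall k, A21 (u k) = 0.
Proof.
move=> du E k; have := coupled_dissipative du.
have -> : rip (C u) u = 0.
  by rewrite E ripZ_self/= mul0r.
rewrite mulNr oppr_ge0 pmulr_rle0// => s0.
have := s0; rewrite (bigD1 k)//= => le0.
apply: hnorm0_eq0; apply/eqP; rewrite -sqrf_eq0 eq_le sqr_ge0 andbT.
apply: le_trans le0; rewrite lerDl sumr_ge0// => j _; exact: sqr_ge0.
Qed.

Lemma eigenvalue_common_kernel :
  (forall beta : R, beta != 0 -> ~ op_eigenvalue C (0 +i* beta)%C) <->
  (forall (beta : R) (Omega' : set Omega), beta != 0 ->
      measurable Omega' -> mu (~` Omega') = 0%E ->
      \bigcap_(x in Omega')
        [set xi : 'cV[R[i]]_N | (((0 +i* beta)%C)%:M - V x) *m xi = 0]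
      = [set 0]).
Proof.
have kerE (beta : R) x (xi : 'cV[R[i]]_N) :
    (((0 +i* beta)%C)%:M - V x) *m xi = 0 <-> V x *m xi = (0 +i* beta)%C *: xi.
  rewrite mulmxBl mul_scalar_mx; split=> [/eqP|->]; last by rewrite subrr.
  by rewrite subr_eq0 => /eqP.
split=> [noeig beta W b0 mW W0|triv beta b0 [u [du u0 E]]].
  apply/seteqP; split => [xi xiW|_ -> x _]; last by rewrite /= mulmx0.
  apply: contrapT => /= xi0; apply: (noeig beta b0).
  have [dxi Cxi] := coupled_wvec xi.
  exists (wvec w xi); split => //.
    by apply/eqP => /(wvec_eq0 w_neq0 L2_nonzero).
  rewrite Cxi; apply/(mulop_wvec_eigen V_measurable V_bounded w_neq0).
  apply: (full_measure_ae mW W0) => x Wx; apply/kerE; exact: xiW.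
have Au0 := imaginary_eigenvector du E.
have dA k : dom A21 (u k) by have [] := du k.
have [c uc] := kernel_wvec dA Au0.
have [_ Cu] := coupled_kernel dA Au0.
have : mulop V (wvec w c) = (0 +i* beta)%C *: wvec w c by rewrite -uc -Cu.
move=> /(mulop_wvec_eigen V_measurable V_bounded w_neq0) /ae_full_measure.
move=> [W [mW W0 Wc]]; have := triv beta W b0 mW W0.
move=> /seteqP[/(_ c) + _] => c0; move/eqP : u0; apply; rewrite uc.
have -> : c = 0 by apply: c0 => x Wx; apply/kerE; exact: Wc.
by apply/ffunP => k; rewrite !ffunE mxE scale0r.
Qed.

End Coupled.

(** The denominator is [N + 1] so that [N = 0] is covered. *)
Lemma sum_split_lt (R : realType) (N : nat) (r : R) : 0 < r ->
  \sum_(k < N) (r / (N%:R + 1)) < r.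
Proof.
move=> r0; have N1 : 0 < N%:R + 1 :> R by rewrite ltr_wpDl.
rewrite sumr_const card_ord -[X in X < _]mulr_natr mulrAC ltr_pdivrMr//.
by rewrite ltr_pM2l// ltrDl.
Qed.

Section Convergence.
Context (R : realType) (d : measure_display)
  (Omega : measurableType d) (mu : {measure set Omega -> \bar R})
  (H2 : hilbertType R) (A21 : operator (L2 mu) H2)
  (N : nat) (S : 'I_N -> {linear H2 -> H2}) (nu : R)
  (V : Omega -> 'M[R[i]]_N) (w : L2 mu).
Hypotheses
  (A21_linear : linear_operator A21)
  (A21_closed : closed_operator A21)
  (A21_dense : densely_defined A21)
  (S_bounded : forall k, bounded_operator (S k))
  (nu_gt0 : 0 < nu)
  (S_coercive : forall k (h : H2), nu * hnorm h ^+ 2 <= rip (S k h) h)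
  (V_measurable : measurable_mx V)
  (V_bounded : ess_bounded_mx mu V)
  (ker_A21 : operator_kernel A21 = [set c *: w | c in [set: R[i]]])
  (V_dissipative : {ae mu, forall x, dissipative_mx (V x)})
  (A21_compact : compactly_embedded A21).

Local Notation C := (coupled_operator A21 S V).
Local Notation X := (hpow N (L2 mu)).

Definition dissipation (u : X) := nu * \sum_(k < N) hnorm (A21 (u k)) ^+ 2.

Lemma dissipation_ge0 u : 0 <= dissipation u.
Proof.
by rewrite mulr_ge0 ?(ltW nu_gt0)// sumr_ge0// => k _; exact: sqr_ge0.
Qed.

Lemma dissipation_term (u : X) k : nu * hnorm (A21 (u k)) ^+ 2 <= dissipation u.
Proof.
rewrite ler_pM2l// (bigD1 k)//= lerDl sumr_ge0// => j _; exact: sqr_ge0.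
Qed.

Lemma coupled_dense : densely_defined C.
Proof.
move=> W [u Wu] Wo.
have /nbhs_ballP[e /= e0 eW] : nbhs u W by exact: open_nbhs_nbhs.
have er : e = (complex.Re e)%:C%C by rewrite RRe_real// gtr0_real.
have r0 : 0 < complex.Re e by rewrite -ltcR -er.
have N1 : 0 < N%:R + 1 :> R by rewrite ltr_wpDl.
have /choice[v Hv] k : exists v, dom (sandwich A21 (S k)) v /\
    hnorm (v - u k) < complex.Re e / (N%:R + 1).
  have [v dv hv] := sandwich_dense A21_linear A21_closed A21_compact A21_dense
    (S_bounded k) nu_gt0 (S_coercive k) (u k) (divr_gt0 r0 N1).
  by exists v.
exists ([ffun k => v k] : X); split; last first.
  by move=> k; rewrite ffunE; exact: (Hv k).1.
apply: eW; rewrite -ball_normE/= er hnormE ltcR hdistC.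
apply: le_lt_trans (hpow_le_sum _) _.
apply: (@le_lt_trans _ _ (\sum_(k < N) (complex.Re e / (N%:R + 1)))).
  by apply: ler_sum => k _; rewrite !ffunE ltW//; exact: (Hv k).2.
exact: sum_split_lt.
Qed.

Lemma wvec_is_linear : linear (wvec (N := N) w).
Proof.
move=> a x y; apply/ffunP => k; rewrite !ffunE !mxE scalerDl scalerA.
by [].
Qed.

(** The components converge along [F] by the compact embedding, and as the
    operator is closed their limits lie in its kernel. *)
Lemma coupled_compact (F : set_system nat) : UltraFilter F -> \oo `<=` F ->
  forall (u : nat -> X) (b : R), (forall n, dom C (u n)) ->
  (forall n, hnorm (u n) <= b) -> dissipation (u n) @[n --> \oo] --> (0 : R) ->
  exists c, u n @[n --> F] --> wvec w c.
Proof.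
move=> FU ooF u b du ub q0.
have dA n k : dom A21 (u n k) by have [] := du n k.
have A0 k : A21 (u n k) @[n --> \oo] --> (0 : H2).
  apply/hcvgP => r r0; have r2 : 0 < nu * r ^+ 2 by rewrite mulr_gt0// exprn_gt0.
  move/cvgrPdist_lt : q0 => /(_ _ r2); apply: filterS => n.
  rewrite sub0r normrN ger0_norm ?dissipation_ge0// subr0.
  move=> /(le_lt_trans (dissipation_term _ k)); rewrite ltr_pM2l//.
  by rewrite ltr_pXn2r// nnegrE ?hnorm_ge0// ltW.
have /choice[l ul] : forall k, exists l : L2 mu, u n k @[n --> F] --> l.
  move=> k; apply: (ultra_cvg A21_compact (a := 1) (b := b)).
    apply: ooF; move/hcvgP : (A0 k) => /(_ 1 ltr01).
    by apply: filterS => n; rewrite subr0 => /ltW.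
  by apply: nearW => n; apply: le_trans (ub n); exact: hpow_le.
have lker k : dom A21 (l k) /\ A21 (l k) = 0.
  apply: (closed_operator_cvg A21_closed _ (ul k)); first exact: nearW.
  by apply: cvg_trans (A0 k); exact: cvg_app.
have [c lc] := kernel_wvec ker_A21 (u := [ffun k => l k])
   (fun k => eq_ind_r (dom A21) (lker k).1 (ffunE _ k))
   (fun k => eq_ind_r (fun x => A21 x = 0) (lker k).2 (ffunE _ k)).
exists c; rewrite -lc; apply/hcvgP => r r0.
have N1 : 0 < N%:R + 1 :> R by rewrite ltr_wpDl.
have : \forall n \near F, forall k : 'I_N, hnorm (u n k - l k) < r / (N%:R + 1).
  apply: filter_forall => k; move/hcvgP : (ul k); apply; exact: divr_gt0.
apply: filterS => n hn; apply: le_lt_trans (hpow_le_sum _) _.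
apply: (@le_lt_trans _ _ (\sum_(k < N) (r / (N%:R + 1)))).
  by apply: ler_sum => k _; rewrite !ffunE ltW.
exact: sum_split_lt.
Qed.

Lemma eigenvalue_convergence (T : R -> {linear X -> X}) :
  C0_semigroup T -> generates C T ->
  (forall beta : R, beta != 0 -> ~ op_eigenvalue C (0 +i* beta)%C) <->
  converges_in_op_norm T.
Proof.
move=> TC0 [dGC GC].
have eigE l : op_eigenvalue C l <-> op_eigenvalue (generator T) l.
  split=> -[u [du u0 E]]; exists u; split => //.
  - by rewrite dGC.
  - by rewrite GC.
  - by rewrite -dGC.
  - by rewrite -GC// -dGC.
have G_dense : densely_defined (generator T).
  by rewrite /densely_defined dGC; exact: coupled_dense.
have G_diss u : dom (generator T) u ->
    rip (generator T u) u <= - dissipation u.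
  rewrite dGC => du; rewrite GC//.
  by rewrite /dissipation -mulNr; exact: coupled_dissipative.
split=> [noeig|conv beta b0 /eigE]; last first.
  exact: (convergent_no_imaginary_eigenvalue TC0 conv b0).
pose M := GRing.isLinear.Build R[i] 'cV[R[i]]_N X *:%R (wvec w) wvec_is_linear.
pose e : {linear 'cV[R[i]]_N -> X} := HB.pack (wvec w) M.
apply: (decay_converges TC0 G_dense dissipation_ge0 G_diss (e := e)).
- by move=> c; rewrite dGC; have [] := coupled_wvec S V A21_dense ker_A21 c.
- move=> F FU ooF u b du; apply: coupled_compact => // k.
  by rewrite -dGC.
- by move=> beta b0 /eigE; exact: noeig.
Qed.

End Convergence.

Theorem theorem5p2 (R : realType) (d : measure_display)
  (Omega : measurableType d) (mu : {measure set Omega -> \bar R})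
  (H2 : hilbertType R) (A21 : operator (L2 mu) H2)
  (N : nat) (S : 'I_N -> {linear H2 -> H2}) (nu : R)
  (V : Omega -> 'M[R[i]]_N) (w : L2 mu)
  (L2_nonzero : exists u : L2 mu, u != 0)
  (H2_nonzero : exists h : H2, h != 0)
  (A21_linear : linear_operator A21)
  (A21_closed : closed_operator A21)
  (A21_dense : densely_defined A21)
  (N_ge1 : (1 <= N)%N)
  (S_bounded : forall k, bounded_operator (S k))
  (nu_gt0 : 0 < nu)
  (S_coercive : forall k (h : H2),
    nu * hnorm h ^+ 2 <= complex.Re (ip (S k h) h))
  (V_measurable : measurable_mx V)
  (V_bounded : ess_bounded_mx mu V)
  (w_neq0 : {ae mu, forall x, repr w x != 0})
  (ker_A21 : operator_kernel A21 = [set c *: w | c in [set: R[i]]])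
  (V_dissipative : {ae mu, forall x, dissipative_mx (V x)}) :
  let C := coupled_operator A21 S V in
  let no_imaginary_eigenvalue :=
    forall beta : R, beta != 0 -> ~ op_eigenvalue C (0 +i* beta)%C in
  let trivial_common_kernel :=
    forall (beta : R) (Omega' : set Omega), beta != 0 ->
      measurable Omega' -> mu (~` Omega') = 0%E ->
      \bigcap_(x in Omega')
        [set xi : 'cV[R[i]]_N | (((0 +i* beta)%C)%:M - V x) *m xi = 0]
      = [set 0] in
  (no_imaginary_eigenvalue <-> trivial_common_kernel) /\
  (compactly_embedded A21 ->
    forall T : R -> {linear hpow N (L2 mu) -> hpow N (L2 mu)},
      C0_semigroup T -> generates C T ->
      (no_imaginary_eigenvalue <-> converges_in_op_norm T) /\
      (trivial_common_kernel <-> converges_in_op_norm T)).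
Proof.
move=> C noeig triv.
have h12 : noeig <-> triv.
  exact: (eigenvalue_common_kernel L2_nonzero A21_dense nu_gt0
    S_coercive V_measurable V_bounded w_neq0 ker_A21 V_dissipative).
split=> // A21_compact T TC0 genT.
have h13 : noeig <-> converges_in_op_norm T.
  exact: (eigenvalue_convergence A21_linear A21_closed A21_dense S_bounded
    nu_gt0 S_coercive V_measurable V_bounded ker_A21 V_dissipative A21_compact).
by split => //; rewrite -h12.
Qed.
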